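(* Let $(A,S)$ be a QP and $k$ a vertex such that for every vertex $i$, $A_{i,k}=0$ or $A_{k,i}=0$, and such that no cyclic path occurring in the expansion of $S$ starts (and ends) at $k$. Then the right-equivalence class of the QP $\widetilde\mu_k(A,S)=(\widetilde A,\widetilde S)$ is determined by the right-equivalence class of $(A,S)$; i.e. if $(A',S')$ is another QP satisfying the same two conditions at $k$ and right-equivalent to $(A,S)$, then $\widetilde\mu_k(A,S)$ and $\widetilde\mu_k(A',S')$ are right-equivalent.
   Context: Fix a field $K$. A quiver $Q$ has finite vertex set $Q_0$ and arrow set $Q_1$, each arrow $a$ going from $t(a)$ to $h(a)$. Let $R=K^{Q_0}$ with idempotents $e_i$, and $A=K^{Q_1}$ the arrow span, an $R$-bimodule with $A_{i,j}=e_iAe_j$ spanned by arrows from $j$ to $i$. The complete path algebra $R\langle\langle A\rangle\rangle=\prod_{d\ge0}A^d$ consists of (possibly infinite) linear combinations of paths $a_1\cdots a_d$ ($t(a_i)=h(a_{i+1})$; a path from $t(a_d)$ to $h(a_1)$), with concatenation product and the $\mathfrak m$-adic topology, $\mathfrak m=\prod_{d\ge1}A^d$. A path is cyclic if $d\geq1$ and $h(a_1)=t(a_d)$; a potential is a possibly infinite linear combination of cyclic paths; two potentials are cyclically equivalent if their difference lies in the closure of the span of all $a_1\cdots a_d-a_2\cdots a_da_1$ (cyclic paths). A QP $(A,S)$: $Q$ has no loops and no two cyclically equivalent cyclic paths occur in $S$. A right-equivalence between QPs $(A,S),(A',S')$ on the same vertex set is an algebra isomorphism $\varphi:R\langle\langle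 A\rangle\rangle\to R\langle\langle A'\rangle\rangle$ with $\varphi|_R=\mathrm{id}$ and $\varphi(S)$ cyclically equivalent to $S'$. Construction $\widetilde\mu_k(A,S)=(\widetilde A,\widetilde S)$ (under the two conditions at $k$): the quiver of $\widetilde A$ has the same vertices and arrows: (i) every arrow of $Q$ not incident to $k$; (ii) for each arrow $a$ with $h(a)=k$ and each arrow $b$ with $t(b)=k$, a new arrow $[ba]:t(a)\to h(b)$; (iii) for each arrow $c$ incident to $k$, an arrow $c^\star$ with reversed orientation ($a^\star:k\to t(a)$, $b^\star:h(b)\to k$). Then $\widetilde S=[S]+\sum_{a,b\in Q_1,\,h(a)=t(b)=k}[ba]a^\star b^\star$, where $[S]$ is obtained by substituting $[a_pa_{p+1}]$ for each factor $a_pa_{p+1}$ with $t(a_p)=h(a_{p+1})=k$ of every cyclic path $a_1\cdots a_d$ occurring in $S$ (this is independent of the choice of arrow bases). *)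

(* Defs.v *)
From HB Require Import structures.
From mathcomp Require Import all_boot all_order all_algebra.
Set Implicit Arguments. Unset Strict Implicit. Unset Printing Implicit Defensive.
Import GRing.Theory.
Local Open Scope ring_scope.

Record quiver (V : finType) := Quiver {
  arr : finType;
  hd : arr -> V;
  tl : arr -> V }.

(* Raw words: (i, s).  For s = [::] this is the trivial path e_i; for
   s = a_1 :: ... :: a_d it is the path a_1 ... a_d (from t a_d to h a_1),
   and i must equal h a_1. *)
Definition is_word (V : finType) (Q : quiver V) (w : V * seq (arr Q)) : bool :=
  match w.2 with
  | [::] => true
  | a :: _ => (w.1 == hd a) && sorted (fun x y => tl x == hd y) w.2
  end.

Definition pth (V : finType) (Q : quiver V) := {w : V * seq (arr Q) | is_word w}.

Definition wtail (V : finType) (Q : quiver V) (w : V * seq (arr Q)) : V :=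
  match w.2 with [::] => w.1 | a :: s => tl (last a s) end.

Definition plen (V : finType) (Q : quiver V) (p : pth Q) : nat := size (sval p).2.

(* Elements of the complete path algebra R<<A>>: arbitrary (possibly infinite)
   K-linear combinations of paths, i.e. coefficient functions on paths. *)
Definition cpa (K : fieldType) (V : finType) (Q : quiver V) := pth Q -> K.

Definition ext (K : fieldType) (V : finType) (Q : quiver V) (f : cpa K Q)
  (w : V * seq (arr Q)) : K :=
  match insub w with Some p => f p | None => 0 end.

Definition cadd (K : fieldType) (V : finType) (Q : quiver V) (f g : cpa K Q) : cpa K Q := fun p => f p + g p.
Definition cscale (K : fieldType) (V : finType) (Q : quiver V) (c : K) (f : cpa K Q) : cpa K Q := fun p => c * f p.

Definition vat (V : finType) (Q : quiver V) (w : V * seq (arr Q)) (j : nat) : V :=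
  match drop j w.2 with a :: _ => hd a | [::] => wtail w end.

Definition cmul (K : fieldType) (V : finType) (Q : quiver V) (f g : cpa K Q) : cpa K Q := fun p =>
  let w := sval p in
  \sum_(j < (size w.2).+1)
     ext f (w.1, take j w.2) * ext g (vat w j, drop j w.2).

(* embedding of R = K^{Q_0}: r = sum_i r_i e_i *)
Definition cemb (K : fieldType) (V : finType) (Q : quiver V) (r : V -> K) : cpa K Q := fun p =>
  if (sval p).2 is [::] then r (sval p).1 else 0.

Definition cone (K : fieldType) (V : finType) (Q : quiver V) : cpa K Q := @cemb K V Q (fun _ => 1).

Definition bas (K : fieldType) (V : finType) (Q : quiver V) (p : pth Q) : cpa K Q := fun q => (q == p)%:R.

Definition cyclicw (V : finType) (Q : quiver V) (w : V * seq (arr Q)) : bool :=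
  (w.2 != [::]) && (w.1 == wtail w).
Definition cyclic (V : finType) (Q : quiver V) (p : pth Q) : bool := cyclicw (sval p).

Definition rotw (V : finType) (Q : quiver V) (w : V * seq (arr Q)) : V * seq (arr Q) :=
  match w.2 with
  | [::] => w
  | a :: s => (hd (head a (rcons s a)), rcons s a)
  end.

Definition spanval (K : fieldType) (V : finType) (Q : quiver V) (l : seq (K * pth Q)) (q : pth Q) : K :=
  \sum_(x <- l) x.1 * ((sval q == sval x.2)%:R - (sval q == rotw (sval x.2))%:R).

(* f - g lies in the m-adic closure of the span of all a_1...a_d - a_2...a_d a_1
   (a_1...a_d cyclic): for every n, f - g agrees with an element of the span
   modulo m^n, i.e. on all paths of length < n. *)
Definition cyc_equiv (K : fieldType) (V : finType) (Q : quiver V) (f g : cpa K Q) : Prop :=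
  forall n : nat, exists l : seq (K * pth Q),
    all (fun x => cyclic x.2) l /\
    forall q : pth Q, (plen q < n)%N -> f q - g q = spanval l q.

Definition potential (K : fieldType) (V : finType) (Q : quiver V) (S : cpa K Q) : Prop :=
  forall p : pth Q, ~~ cyclic p -> S p = 0.

Definition isQP (K : fieldType) (V : finType) (Q : quiver V) (S : cpa K Q) : Prop :=
  [/\ (forall a : arr Q, hd a != tl a),
      potential S &
      (forall p q : pth Q, cyclic p -> cyclic q -> S p != 0 -> S q != 0 ->
         p != q -> ~ cyc_equiv (@bas K V Q p) (@bas K V Q q))].

Definition cond_at (K : fieldType) (V : finType) (Q : quiver V) (k : V) (S : cpa K Q) : Prop :=
  (forall i : V, (forall a : arr Q, ~~ ((tl a == k) && (hd a == i))) \/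
                 (forall a : arr Q, ~~ ((tl a == i) && (hd a == k)))) /\
  (forall p : pth Q, S p != 0 -> cyclic p -> (sval p).1 != k).

Definition alg_iso (K : fieldType) (V : finType) (Q Q' : quiver V) (phi : cpa K Q -> cpa K Q') : Prop :=
  [/\ bijective phi,
      (forall f g, phi (cadd f g) = cadd (phi f) (phi g)),
      (forall (c : K) f, phi (cscale c f) = cscale c (phi f)),
      (forall f g, phi (cmul f g) = cmul (phi f) (phi g)) &
      phi (@cone K V Q) = @cone K V Q'].

Definition right_equiv (K : fieldType) (V : finType) (Q Q' : quiver V) (S : cpa K Q) (S' : cpa K Q') : Prop :=
  exists phi : cpa K Q -> cpa K Q',
    [/\ alg_iso phi, (forall r : V -> K, phi (@cemb K V Q r) = @cemb K V Q' r) &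
        cyc_equiv (phi S) S'].

(* letters: inl (inl a) = old arrow a (not incident to k);
            inl (inr (a,b)) = [ba] (h a = k = t b);
            inr c = c^* (c incident to k) *)
Definition letter (V : finType) (Q : quiver V) : finType := ((arr Q + (arr Q * arr Q)) + arr Q)%type.

Definition valid_letter (V : finType) (Q : quiver V) (k : V) (x : letter Q) : bool :=
  match x with
  | inl (inl a) => (hd a != k) && (tl a != k)
  | inl (inr (a, b)) => (hd a == k) && (tl b == k)
  | inr c => (hd c == k) || (tl c == k)
  end.

Definition hd_letter (V : finType) (Q : quiver V) (x : letter Q) : V :=
  match x with
  | inl (inl a) => hd a
  | inl (inr (a, b)) => hd b
  | inr c => tl c
  end.

Definition tl_letter (V : finType) (Q : quiver V) (x : letter Q) : V :=
  match x with
  | inl (inl a) => tl a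
  | inl (inr (a, b)) => tl a
  | inr c => hd c
  end.

Definition mut_arr (V : finType) (Q : quiver V) (k : V) : finType :=
  {x : letter Q | valid_letter k x}.

Definition mut_quiver (V : finType) (Q : quiver V) (k : V) : quiver V :=
  @Quiver V (mut_arr Q k) (fun x => hd_letter (sval x)) (fun x => tl_letter (sval x)).

(* substitution of [a_p a_{p+1}] for each factor a_p a_{p+1} with
   t(a_p) = h(a_{p+1}) = k (None if some arrow incident to k is left over) *)
Fixpoint substw V (Q : quiver V) (k : V) (s : seq (arr Q)) : option (seq (letter Q)) :=
  match s with
  | [::] => Some [::]
  | b :: s1 =>
    if (hd b != k) && (tl b != k) then omap (cons (inl (inl b))) (substw k s1)
    else if tl b == k then
      match s1 with
      | a :: s2 => if hd a == k then omap (cons (inl (inr (a, b)))) (substw k s2)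
                   else None
      | [::] => None
      end
    else None
  end.

(* the (unique candidate) preimage of a word under the substitution *)
Fixpoint unsubstw V (Q : quiver V) (s : seq (letter Q)) : option (seq (arr Q)) :=
  match s with
  | [::] => Some [::]
  | inl (inl a) :: s1 => omap (cons a) (unsubstw s1)
  | inl (inr (a, b)) :: s1 => omap (fun r => b :: a :: r) (unsubstw s1)
  | inr _ :: _ => None
  end.

(* [S]: coefficient of q is the coefficient in S of the path p whose
   substitution is q (0 if there is none) *)
Definition bracketS (K : fieldType) (V : finType) (Q : quiver V) (k : V) (S : cpa K Q) : cpa K (mut_quiver Q k) :=
  fun q =>
    let raw := map (@sval _ _) (sval q).2 in
    match unsubstw raw with
    | Some s => if substw k s == Some raw then ext S ((sval q).1, s) else 0
    | None => 0
    end.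

(* sum_{a,b : h a = t b = k} [ba] a^* b^* : coefficient 1 exactly on these paths *)
Definition triangles (K : fieldType) (V : finType) (Q : quiver V) (k : V) : cpa K (mut_quiver Q k) :=
  fun q =>
    ([exists a : arr Q, exists b : arr Q,
        [&& hd a == k, tl b == k &
            map (@sval _ _) (sval q).2 == [:: inl (inr (a, b)); inr a; inr b]]] : bool)%:R.


Definition mut_pot (K : fieldType) (V : finType) (Q : quiver V) (k : V) (S : cpa K Q) : cpa K (mut_quiver Q k) :=
  cadd (@bracketS K V Q k S) (@triangles K V Q k).
Arguments mut_pot [K V Q] k S _.
Arguments cond_at [K V Q] k S.

(* Main.v *)
(** Let [phi : R<<A>> -> R<<A'>>] be a right-equivalence with inverse [psi]; it is
    automatically continuous, since [1 - x] is invertible for [x] in the arrow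
    ideal. Write [phi a_i = sum_j a'_j C_ji] for the arrows [a_i] entering [k] and
    [phi b_i = sum_j D_ij b'_j] for the arrows [b_i] leaving [k]. Then [phi] extends
    to an isomorphism of the mutated algebras sending [a_i^*] to
    [sum_j (C^-1)_ij a'_j^*] and [b_i^*] to [sum_j b'_j^* (D^-1)_ji]. It maps [[S]]
    to [[phi S]], and it maps the triangle potential to the other one up to moving
    the factor [D^-1] cyclically to the front. *)

Require Import Defs.
From HB Require Import structures.
From mathcomp Require Import all_boot all_order all_algebra.
From mathcomp Require Import boolp.
From mathcomp Require Import zify.
Set Implicit Arguments. Unset Strict Implicit. Unset Printing Implicit Defensive.
Import GRing.Theory.
Local Open Scope ring_scope.

(** * The path algebra as a ring *)

(** The bracket is not a homomorphism, and it discards every nontrivial path that starts or ends at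
    [k]; it becomes multiplicative on the corner (1 - e_k) R<<A>> (1 - e_k). There it is inverted by
    the homomorphism that expands [ba] into ba, so its compatibility with [phi] reduces to comparing
    homomorphisms on arrows. No matrix has to be inverted: applying [phi] to the expansion of
    [psi a'_j] along first arrows displays the entries of C^-1, and last arrows give D^-1 in the
    same way. The second obstacle is cyclic equivalence. Both [phi S] and [S'] lie in the corner,
    but the rotations that relate them may pass through cycles based at [k], on which the bracket
    vanishes. A corrected bracket, which first moves such cycles off [k] and agrees with the bracket
    on the corner, carries the relation across. *)

Section Words.
Variables (K : fieldType) (V : finType) (Q : quiver V).
Local Notation word := (V * seq (arr Q))%type.
Implicit Types (f g h : cpa K Q) (w : word) (a b : arr Q) (i j : V).

Lemma is_word_cons i a s :
  is_word (i, a :: s) = (i == hd a) && is_word (Q := Q) (tl a, s).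
Proof.
rewrite /is_word /=; case: s => [|b s] //=.
Qed.

Lemma wtail_cons i a s : wtail (Q := Q) (i, a :: s) = wtail (tl a, s).
Proof. by case: s. Qed.

Lemma is_word_rcons i s a :
  is_word (i, rcons s a) = is_word (i, s) && (wtail (i, s) == hd a).
Proof.
elim: s i => [|b s IH] i; first by rewrite is_word_cons /= /wtail andbT.
by rewrite rcons_cons !is_word_cons IH wtail_cons andbA.
Qed.

Lemma wtail_rcons i s a : wtail (Q := Q) (i, rcons s a) = tl a.
Proof.
by elim: s i => [|b s IH] i //; rewrite rcons_cons wtail_cons.
Qed.

Lemma ext_val f (p : pth Q) : ext f (sval p) = f p.
Proof. by rewrite /ext valK. Qed.

Lemma ext_out f w : ~~ is_word w -> ext f w = 0.
Proof. by move=> nw; rewrite /ext insubN. Qed.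

Lemma ext_in f w (h : is_word w) : ext f w = f (exist _ w h).
Proof. by rewrite -[w]/(sval (exist (fun w => is_word w) w h)) ext_val. Qed.

(** Extensionality over raw words: these can be cut and extended freely, and the default value 0 of
    [ext] stands in for the proof that a word is a path. *)
Lemma cpaP f g : (forall w, is_word w -> ext f w = ext g w) -> f = g.
Proof. by move=> e; apply/funext => -[w h]; rewrite -!ext_val /= e. Qed.

End Words.

HB.instance Definition _ (K : fieldType) (V : finType) (Q : quiver V) :=
  gen_eqMixin (cpa K Q).
HB.instance Definition _ (K : fieldType) (V : finType) (Q : quiver V) :=
  gen_choiceMixin (cpa K Q).

Section Additive.
Variables (K : fieldType) (V : finType) (Q : quiver V).
Implicit Types (f g h : cpa K Q) (c : K).

Definition czero : cpa K Q := fun=> 0.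
Definition copp f : cpa K Q := fun p => - f p.

Fact caddA : associative (@cadd K V Q).
Proof. by move=> f g h; apply/funext => p; rewrite /cadd addrA. Qed.
Fact caddC : commutative (@cadd K V Q).
Proof. by move=> f g; apply/funext => p; rewrite /cadd addrC. Qed.
Fact cadd0 : left_id czero (@cadd K V Q).
Proof. by move=> f; apply/funext => p; rewrite /cadd add0r. Qed.
Fact caddN : left_inverse czero copp (@cadd K V Q).
Proof. by move=> f; apply/funext => p; rewrite /cadd addNr. Qed.

HB.instance Definition _ :=
  GRing.isZmodule.Build (cpa K Q) caddA caddC cadd0 caddN.

Fact cscaleA c d f : cscale c (cscale d f) = cscale (c * d) f.
Proof. by apply/funext => p; rewrite /cscale mulrA. Qed.
Fact cscale1 : left_id 1 (@cscale K V Q).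
Proof. by move=> f; apply/funext => p; rewrite /cscale mul1r. Qed.
Fact cscaleDr : right_distributive (@cscale K V Q) +%R.
Proof. by move=> c f g; apply/funext => p; rewrite /cscale /= mulrDr. Qed.
Fact cscaleDl f : {morph (@cscale K V Q)^~ f : c d / c + d}.
Proof. by move=> c d; apply/funext => p; rewrite /cscale /= mulrDl. Qed.

HB.instance Definition _ := GRing.Zmodule_isLmodule.Build K (cpa K Q)
  cscaleA cscale1 cscaleDr cscaleDl.

Lemma ext0 w : ext (0 : cpa K Q) w = 0.
Proof. by rewrite /ext; case: insub. Qed.
Lemma extD f g w : ext (f + g) w = ext f w + ext g w.
Proof. by rewrite /ext; case: insub => //; rewrite addr0. Qed.
Lemma extN f w : ext (- f) w = - ext f w.
Proof. by rewrite /ext; case: insub => //; rewrite oppr0. Qed.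
Lemma extB f g w : ext (f - g) w = ext f w - ext g w.
Proof. by rewrite extD extN. Qed.
Lemma extZ c f w : ext (c *: f) w = c * ext f w.
Proof. by rewrite /ext; case: insub => //; rewrite mulr0. Qed.
Lemma ext_sum I (r : seq I) (P : pred I) (F : I -> cpa K Q) w :
  ext (\sum_(x <- r | P x) F x) w = \sum_(x <- r | P x) ext (F x) w.
Proof. by apply: (big_morph (fun f => ext f w)) => [f g|]; rewrite ?extD ?ext0. Qed.

End Additive.

Section Ring.
Variables (K : fieldType) (V : finType) (Q : quiver V).
Local Notation word := (V * seq (arr Q))%type.
Implicit Types (f g h : cpa K Q) (w : word) (a b : arr Q) (i j : V).

(** The coordinate at [a] when the arrow ideal is decomposed along first arrows ([ldiv_sum]).
    Inductions on path length and the entries of C^-1 both go through it. *)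
Definition ldiv a f : cpa K Q := fun p =>
  if (sval p).1 == tl a then ext f (hd a, a :: (sval p).2) else 0.

Lemma ext_ldiv a f i s :
  ext (ldiv a f) (i, s) = if i == tl a then ext f (hd a, a :: s) else 0.
Proof.
have [h|h] := boolP (is_word (i, s)); first by rewrite (ext_in _ h).
rewrite (ext_out _ h); case: eqP => // e; rewrite ext_out //.
by rewrite is_word_cons eqxx -e.
Qed.

Lemma cmulE f g i s : is_word (i, s) ->
  ext (cmul f g) (i, s) =
  \sum_(j < (size s).+1) ext f (i, take j s) * ext g (vat (i, s) j, drop j s).
Proof. by move=> h; rewrite (ext_in _ h). Qed.

Lemma cmul_nil f g i :
  ext (cmul f g) (i, [::]) = ext f (i, [::]) * ext g (i, [::]).
Proof. by rewrite cmulE // big_ord_recl big_ord0 addr0. Qed.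

Lemma vat_cons i a s n : vat (Q := Q) (i, a :: s) n.+1 = vat (tl a, s) n.
Proof. by rewrite /vat /=; case: drop => //; rewrite wtail_cons. Qed.

Lemma cmul_cons f g a s : is_word (tl a, s) ->
  ext (cmul f g) (hd a, a :: s) =
  ext f (hd a, [::]) * ext g (hd a, a :: s) + ext (cmul (ldiv a f) g) (tl a, s).
Proof.
move=> h; rewrite !cmulE ?is_word_cons ?eqxx // big_ord_recl; congr (_ + _).
by apply: eq_bigr => j _; rewrite /= vat_cons ext_ldiv eqxx.
Qed.

Lemma cmulDl : left_distributive (@cmul K V Q) +%R.
Proof.
move=> f g h; apply: cpaP => -[i s] w; rewrite extD !cmulE // -big_split /=.
by apply: eq_bigr => j _; rewrite extD mulrDl.
Qed.

Lemma cmulDr : right_distributive (@cmul K V Q) +%R.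
Proof.
move=> f g h; apply: cpaP => -[i s] w; rewrite extD !cmulE // -big_split /=.
by apply: eq_bigr => j _; rewrite extD mulrDr.
Qed.

Lemma cmulZl c f g : cmul (c *: f) g = c *: cmul f g.
Proof.
apply: cpaP => -[i s] w; rewrite extZ !cmulE // mulr_sumr.
by apply: eq_bigr => j _; rewrite extZ mulrA.
Qed.

Lemma cmulZr c f g : cmul f (c *: g) = c *: cmul f g.
Proof.
apply: cpaP => -[i s] w; rewrite extZ !cmulE // mulr_sumr.
by apply: eq_bigr => j _; rewrite extZ mulrCA.
Qed.

Lemma ext_emb (r : V -> K) i s :
  ext (@cemb K V Q r) (i, s) = if s is [::] then r i else 0.
Proof.
have [h|h] := boolP (is_word (i, s)); first by rewrite (ext_in _ h).
by rewrite ext_out //; case: s h.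
Qed.

Lemma ext_emb_mul (r : V -> K) f i s :
  ext (cmul (@cemb K V Q r) f) (i, s) = r i * ext f (i, s).
Proof.
have [h|h] := boolP (is_word (i, s)); last by rewrite !ext_out ?mulr0.
rewrite cmulE // big_ord_recl take0 ext_emb big1 ?addr0 => [|j _].
  congr (_ * ext f (_, _)).
  rewrite /vat drop0; case: s h => //= a s.
  by rewrite is_word_cons => /andP[/eqP].
  by rewrite drop0.
by rewrite ext_emb; case: s h j => [|a s] h j /=; rewrite ?mul0r //; case: j.
Qed.

Lemma ext_mul_emb (r : V -> K) f i s :
  ext (cmul f (@cemb K V Q r)) (i, s) = ext f (i, s) * r (wtail (i, s)).
Proof.
have [h|h] := boolP (is_word (i, s)); last by rewrite !ext_out ?mul0r.
rewrite cmulE // big_ord_recr /= take_size drop_size ext_emb big1 ?add0r.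
  by rewrite /vat drop_size.
move=> j _; rewrite ext_emb; case e: drop => [|b t]; rewrite /= ?mulr0 //.
by have := size_drop j s; rewrite e /=; have := ltn_ord j; lia.
Qed.

(** A Fox derivative rule: the first arrow of a product comes from [f], or from [g] when [f]
    contributes only its constant term. *)
Lemma ldiv_mul a f g :
  ldiv a (cmul f g) = ext f (hd a, [::]) *: ldiv a g + cmul (ldiv a f) g.
Proof.
apply: cpaP => -[i s] w; rewrite ext_ldiv extD extZ ext_ldiv.
case: eqP w => [-> w|n w]; first by rewrite cmul_cons.
rewrite mulr0 add0r cmulE // big1 // => j _; rewrite ext_ldiv.
by case: eqP n => //; rewrite mul0r.
Qed.

(** Peeling off the first arrow with [ldiv_mul] gives an induction on the path and avoids reindexing
    a double sum over cut points. *)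
Lemma cmulA : associative (@cmul K V Q).
Proof.
move=> f g h; apply: cpaP => -[i s].
elim: s i f g h => [|a s IH] i f g h w; first by rewrite !cmul_nil mulrA.
move: w; rewrite is_word_cons => /andP[/eqP -> w].
rewrite !cmul_cons // cmul_nil ldiv_mul cmulDl cmulZl extD extZ -IH //.
by rewrite mulrDr mulrA addrA.
Qed.

Lemma cmul1 : left_id (@cone K V Q) (@cmul K V Q).
Proof. by move=> f; apply: cpaP => -[i s] _; rewrite ext_emb_mul mul1r. Qed.

Lemma cmulr1 : right_id (@cone K V Q) (@cmul K V Q).
Proof. by move=> f; apply: cpaP => -[i s] _; rewrite ext_mul_emb mulr1. Qed.

HB.instance Definition _ := GRing.Zmodule_isPzRing.Build (cpa K Q)
  cmulA cmul1 cmulr1 cmulDl cmulDr.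

Lemma ext_mul_nil f g i :
  ext (f * g) (i, [::]) = ext f (i, [::]) * ext g (i, [::]).
Proof. exact: cmul_nil. Qed.

Lemma ext_mul_cons f g a s : is_word (tl a, s) ->
  ext (f * g) (hd a, a :: s) =
  ext f (hd a, [::]) * ext g (hd a, a :: s) + ext (ldiv a f * g) (tl a, s).
Proof. exact: cmul_cons. Qed.

Lemma cpaZl c f g : (c *: f) * g = c *: (f * g).
Proof. exact: cmulZl. Qed.

Lemma cpaZr c f g : f * (c *: g) = c *: (f * g).
Proof. exact: cmulZr. Qed.

(* [(q == w)] as a function of [q], hence [0] when [w] is not a path. *)
Definition mono w : cpa K Q := fun p => (sval p == w)%:R.
Definition ev i : cpa K Q := @cemb K V Q (fun j => (j == i)%:R).
Definition ar a : cpa K Q := mono (hd a, [:: a]).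

Lemma ext_mono w w' : ext (mono w) w' = ((w' == w) && is_word w)%:R.
Proof.
have [h|h] := boolP (is_word w').
  by rewrite (ext_in _ h) /mono /=; case: eqP => // <-; rewrite h.
by rewrite ext_out //; case: eqP => // <-; rewrite (negbTE h).
Qed.

Lemma ext_evM i f j s : ext (ev i * f) (j, s) = (j == i)%:R * ext f (j, s).
Proof. exact: ext_emb_mul. Qed.

Lemma ext_Mev i f j s :
  ext (f * ev i) (j, s) = ext f (j, s) * (wtail (j, s) == i)%:R.
Proof. exact: ext_mul_emb. Qed.

Lemma mono_nil i : mono (i, [::]) = ev i.
Proof.
apply: cpaP => -[j s] _; rewrite ext_mono ext_emb xpair_eqE andbT.
by case: s => [|b s] /=; rewrite ?andbT ?andbF.
Qed.

Lemma evM i j : ev i * ev j = if i == j then ev i else 0.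
Proof.
apply: cpaP => -[l s] _; rewrite ext_evM ext_emb.
case: ifP => [/eqP->|n]; rewrite ?ext_emb ?ext0; case: s => [|_ _]; rewrite ?mulr0 //.
  by case: eqP; rewrite ?mul0r ?mul1r.
by case: (l =P i) => [->|]; rewrite ?mul0r // n mulr0.
Qed.

Lemma sum_ev : \sum_i ev i = 1.
Proof.
apply: cpaP => -[j s] _; rewrite ext_sum ext_emb; under eq_bigr do rewrite ext_emb.
case: s => [|_ _]; last by rewrite big1.
rewrite (bigD1 j) //= eqxx big1 ?addr0 // => i.
by rewrite eq_sym => /negbTE ->.
Qed.

Lemma ldivM a f g :
  ldiv a (f * g) = ext f (hd a, [::]) *: ldiv a g + ldiv a f * g.
Proof. exact: ldiv_mul. Qed.

Lemma ldivD a f g : ldiv a (f + g) = ldiv a f + ldiv a g.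
Proof.
by apply: cpaP => -[i s] _; rewrite extD !ext_ldiv extD; case: eqP; rewrite ?addr0.
Qed.

Lemma ldivZ a c f : ldiv a (c *: f) = c *: ldiv a f.
Proof.
by apply: cpaP => -[i s] _; rewrite extZ !ext_ldiv extZ; case: eqP; rewrite ?mulr0.
Qed.

Lemma ldiv_ar a b : ldiv a (ar b) = if a == b then ev (tl a) else 0.
Proof.
apply: cpaP => -[i s] _; rewrite ext_ldiv ext_mono is_word_cons eqxx /= andbT.
rewrite xpair_eqE eqseq_cons; case: (a =P b) => [->|n]; last first.
  by rewrite andbF ext0; case: ifP.
by rewrite ext_emb eqxx /=; case: s => [|_ _] //=; case: ifP.
Qed.

Lemma ext_arM a f i s : ext (ar a * f) (i, s) =
  if s is b :: t then ((i == hd a) && (b == a))%:R * ext f (tl a, t) else 0.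
Proof.
have [w|w] := boolP (is_word (i, s)); last first.
  rewrite ext_out //; case: s w => [|b t] //; rewrite is_word_cons.
  case: (i =P hd a) => [->|] w; rewrite ?mul0r //=.
  case: (b =P a) w => [->|] w; rewrite ?mul0r //; rewrite eqxx in w.
  by rewrite ext_out ?mulr0.
case: s w => [|b t] w.
  by rewrite ext_mul_nil ext_mono xpair_eqE andbF /= mul0r.
move: w; rewrite is_word_cons => /andP[/eqP -> w].
rewrite ext_mul_cons // ext_mono xpair_eqE andbF mul0r add0r.
rewrite ldiv_ar; case: (b =P a) => [e|n]; last by rewrite andbF mul0r mul0r ext0.
by rewrite e eqxx ext_evM -e eqxx.
Qed.

Lemma ar_mono a i s :
  ar a * mono (i, s) = if i == tl a then mono (hd a, a :: s) else 0.
Proof.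
apply: cpaP => -[j t] _; rewrite ext_arM; case: t => [|b t].
  by case: ifP; rewrite ?ext0 // ext_mono xpair_eqE andbF.
case: ifP => [/eqP -> |n]; rewrite ?ext0 !ext_mono !xpair_eqE ?(eq_sym (tl a)) ?n.
  rewrite eqxx eqseq_cons is_word_cons eqxx /= -natrM mulnb -!andbA //.
by rewrite mulr0.
Qed.

Lemma evl_ar a : ev (hd a) * ar a = ar a.
Proof.
apply: cpaP => -[j s] _; rewrite ext_evM ext_mono xpair_eqE.
by case: eqP; rewrite ?mul1r ?mul0r.
Qed.

Lemma evr_ar a : ar a * ev (tl a) = ar a.
Proof. by rewrite -mono_nil ar_mono eqxx. Qed.

Lemma ldiv_evl a f : ev (tl a) * ldiv a f = ldiv a f.
Proof.
apply: cpaP => -[i s] _; rewrite ext_evM ext_ldiv.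
by case: eqP; rewrite ?mulr0 ?mul1r.
Qed.

Lemma ldiv_evr a f j : f * ev j = f -> ldiv a f * ev j = ldiv a f.
Proof.
move=> e; apply: cpaP => -[i s] _; rewrite ext_Mev ext_ldiv.
case: eqP => [->|]; rewrite ?mul0r // -[in RHS]e ext_Mev.
by rewrite wtail_cons.
Qed.

(* [inm N f] says that [f] lies in the [N]-th power of the arrow ideal. *)
Definition inm (N : nat) f := forall w, (size w.2 < N)%N -> ext f w = 0.

Lemma inm0n f : inm 0 f. Proof. by []. Qed.
Lemma inm_0 N : inm N 0. Proof. by move=> w _; rewrite ext0. Qed.
Lemma inmD N f g : inm N f -> inm N g -> inm N (f + g).
Proof. by move=> hf hg w s; rewrite extD hf ?hg ?addr0. Qed.
Lemma inmN N f : inm N f -> inm N (- f).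
Proof. by move=> hf w s; rewrite extN hf ?oppr0. Qed.
Lemma inmB N f g : inm N f -> inm N g -> inm N (f - g).
Proof. by move=> hf hg; apply/inmD/inmN. Qed.
Lemma inmZ N c f : inm N f -> inm N (c *: f).
Proof. by move=> hf w s; rewrite extZ hf ?mulr0. Qed.
Lemma inm_sum N I (r : seq I) (P : pred I) (F : I -> cpa K Q) :
  (forall x, P x -> inm N (F x)) -> inm N (\sum_(x <- r | P x) F x).
Proof. by move=> h; apply: big_ind => //; [exact: inm_0 | exact: inmD]. Qed.
Lemma inm_le M N f : (N <= M)%N -> inm M f -> inm N f.
Proof. by move=> le hf w s; rewrite hf // (leq_trans s). Qed.

Lemma inmM M N f g : inm M f -> inm N g -> inm (M + N) (f * g).
Proof.
move=> hf hg [i s] /= lt; have [w|w] := boolP (is_word (i, s)); last exact: ext_out.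
rewrite [LHS]cmulE // big1 // => j _.
have [ltj|lej] := ltnP j M.
  by rewrite hf ?mul0r //= size_take_min gtn_min ltj.
by rewrite hg ?mulr0 //= size_drop; have := ltn_ord j; lia.
Qed.

Lemma inmMl N f g : inm N f -> inm N (f * g).
Proof. by move=> h; rewrite -[N]addn0; apply: inmM. Qed.
Lemma inmMr N f g : inm N g -> inm N (f * g).
Proof. by move=> h; rewrite -[N]add0n; apply: inmM. Qed.

Lemma inm_inf f : (forall N, inm N f) -> f = 0.
Proof. by move=> h; apply: cpaP => w _; rewrite (h (size w.2).+1) ?ext0. Qed.

Lemma inm_ar a : inm 1 (ar a).
Proof. by move=> [i [|b s]] // _; rewrite ext_mono xpair_eqE andbF. Qed.

Lemma inm_ldiv N a f : inm N.+1 f -> inm N (ldiv a f).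
Proof. by move=> h [i s] /= lt; rewrite ext_ldiv h //; case: ifP. Qed.

Lemma ldiv_sum f : inm 1 f -> f = \sum_a ar a * ldiv a f.
Proof.
move=> h; apply: cpaP => -[i [|b s]] w.
  by rewrite h // ext_sum big1 // => a _; rewrite ext_arM.
move: w; rewrite is_word_cons => /andP[/eqP-> _].
rewrite ext_sum (bigD1 b) //= ext_arM ext_ldiv !eqxx mul1r big1 ?addr0 // => a.
by rewrite eq_sym ext_arM => /negbTE ->; rewrite andbF mul0r.
Qed.

Lemma ldivM1 a f g : inm 1 f -> ldiv a (f * g) = ldiv a f * g.
Proof. by move=> h; rewrite ldivM h // scale0r add0r. Qed.

(** Mirror image of [ldiv], needed for the arrows leaving [k], whose matrix D acts from the left. *)
Definition rdiv a f : cpa K Q := fun p =>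
  if wtail (sval p) == hd a then ext f ((sval p).1, rcons (sval p).2 a) else 0.

Lemma ext_rdiv a f i s :
  ext (rdiv a f) (i, s) =
  if wtail (i, s) == hd a then ext f (i, rcons s a) else 0.
Proof.
have [h|h] := boolP (is_word (i, s)); first by rewrite (ext_in _ h).
rewrite (ext_out _ h); case: eqP => // e; rewrite ext_out //.
by rewrite is_word_rcons negb_and h.
Qed.

Lemma ext_Mar a f i s b : is_word (i, rcons s b) ->
  ext (f * ar a) (i, rcons s b) = (b == a)%:R * ext f (i, s).
Proof.
elim: s i f => [|c s IH] i f.
  rewrite is_word_cons => /andP[/eqP -> _]; rewrite ext_mul_cons //.
  rewrite ext_mono xpair_eqE eqseq_cons andbT is_word_cons eqxx.
  rewrite ext_mul_nil ext_mono xpair_eqE andbF mulr0 addr0.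
  by case: (b =P a) => [->|]; rewrite ?eqxx ?andbF ?mulr0 ?mul0r ?mulr1 ?mul1r.
rewrite rcons_cons is_word_cons => /andP[/eqP -> w]; rewrite ext_mul_cons //.
rewrite ext_mono xpair_eqE eqseq_cons -size_eq0 size_rcons !andbF mulr0 add0r.
by rewrite [LHS]IH // ext_ldiv eqxx.
Qed.

Lemma ext_Mar0 a f i : ext (f * ar a) (i, [::]) = 0.
Proof. by rewrite ext_mul_nil ext_mono xpair_eqE andbF mulr0. Qed.

Lemma rdiv_sum f : inm 1 f -> f = \sum_a rdiv a f * ar a.
Proof.
move=> h; apply: cpaP => -[i s] w; rewrite ext_sum.
case/lastP: s w => [|s b] w.
  by rewrite h // big1 // => a _; rewrite ext_Mar0.
have := w; rewrite is_word_rcons => /andP[_ wt].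
rewrite (bigD1 b) //= ext_Mar // ext_rdiv wt !eqxx mul1r big1 ?addr0 // => a.
by rewrite eq_sym ext_Mar // => /negbTE ->; rewrite mul0r.
Qed.

Lemma rdiv_evr a f : rdiv a f * ev (hd a) = rdiv a f.
Proof.
apply: cpaP => -[i s] _; rewrite ext_Mev ext_rdiv.
by case: eqP; rewrite ?mul0r ?mulr1.
Qed.

Lemma rdiv_evl a f j : ev j * f = f -> ev j * rdiv a f = rdiv a f.
Proof.
move=> e; apply: cpaP => -[i s] _; rewrite ext_evM ext_rdiv.
by case: ifP => _; rewrite ?mulr0 // -[in RHS]e ext_evM.
Qed.

Lemma rdivMar a b f : rdiv a (f * ar b) = if a == b then f * ev (hd a) else 0.
Proof.
apply: cpaP => -[i s] w; rewrite ext_rdiv; case: eqP => [e|n].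
  rewrite ext_Mar ?is_word_rcons ?w ?e ?eqxx //.
  by case: eqP; rewrite ?mul0r ?ext0 // ext_Mev e eqxx mul1r mulr1.
case: ifP => _; rewrite ?ext0 // ext_Mev.
by case: eqP n => // ; rewrite mulr0.
Qed.

Lemma rdivD a f g : rdiv a (f + g) = rdiv a f + rdiv a g.
Proof.
by apply: cpaP => -[i s] _; rewrite extD !ext_rdiv extD; case: eqP; rewrite ?addr0.
Qed.

Lemma rdiv_sumr a I (r : seq I) (P : pred I) (F : I -> cpa K Q) :
  rdiv a (\sum_(x <- r | P x) F x) = \sum_(x <- r | P x) rdiv a (F x).
Proof.
apply: (big_morph (rdiv a)) => [f g|]; first exact: rdivD.
by apply: cpaP => -[i s] _; rewrite ext_rdiv !ext0; case: ifP.
Qed.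

Lemma rdivM1 a f g : inm 1 g -> rdiv a (f * g) = f * rdiv a g.
Proof.
move=> h; rewrite {1}(rdiv_sum h) mulr_sumr rdiv_sumr (bigD1 a) //= mulrA rdivMar.
rewrite eqxx -mulrA rdiv_evr big1 ?addr0 // => b.
by rewrite mulrA rdivMar eq_sym => /negbTE ->.
Qed.

End Ring.
Arguments ar K [V Q].
Arguments ev K [V] Q.

(** * Continuous linear maps and homomorphisms *)

Section Truncation.
Variables (K : fieldType) (V : finType) (Q : quiver V).
Local Notation word := (V * seq (arr Q))%type.
Implicit Types (f g h : cpa K Q) (w : word) (a b : arr Q) (i j : V) (N : nat).

(** A duplicate-free finite list, so that truncation modulo a power of the arrow ideal is a finite
    sum. It also contains words that are not paths; their coefficients are 0. *)
Definition words N : seq word :=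
  map (fun w : V * {bseq N of arr Q} => (w.1, bseqval w.2))
    (filter (fun w : V * {bseq N of arr Q} => size w.2 < N)%N
       (enum {: V * {bseq N of arr Q}})).

Lemma words_uniq N : uniq (words N).
Proof.
rewrite map_inj_uniq; first exact/filter_uniq/enum_uniq.
by move=> [i s] [j t] /= [-> /val_inj ->].
Qed.

Lemma mem_words N w : (w \in words N) = (size w.2 < N)%N.
Proof.
apply/mapP/idP => [[[i s]] + ->|]; first by rewrite mem_filter => /andP[].
case: w => i s /= lt; have le : (size s <= N)%N by exact: ltnW.
by exists (i, Bseq le); rewrite // mem_filter /= lt mem_enum.
Qed.

Lemma inm_tr N f : inm N (f - \sum_(w <- words N) ext f w *: mono K w).
Proof.
move=> v lt; rewrite extB ext_sum; have [h|h] := boolP (is_word v); last first.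
  by rewrite ext_out // big1 ?subr0 // => w _; rewrite [ext _ v]ext_out.
rewrite (bigD1_seq v) ?words_uniq ?mem_words //= extZ ext_mono eqxx h mulr1.
rewrite big1 ?addr0 ?subrr // => w n.
by rewrite extZ ext_mono eq_sym (negbTE n) mulr0.
Qed.

(* Linear subspaces closed for the adic topology. *)
Definition closed_sub (Z : cpa K Q -> Prop) : Prop :=
  [/\ Z 0, forall f g, Z f -> Z g -> Z (f + g), forall c f, Z f -> Z (c *: f) &
      forall f, (forall N, exists g, Z g /\ inm N (f - g)) -> Z f].

Lemma closed_sum Z : closed_sub Z ->
  forall I (r : seq I) (P : pred I) (F : I -> cpa K Q),
  (forall x, P x -> Z (F x)) -> Z (\sum_(x <- r | P x) F x).
Proof. by case=> z0 zD _ _ I r P F h; apply: big_ind. Qed.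

Lemma closed_sub0 : closed_sub (fun f => f = 0).
Proof.
split=> [//|f g -> ->|c f ->|f h]; rewrite ?addr0 ?scaler0 //.
by apply: inm_inf => N; have [g [-> ]] := h N; rewrite subr0.
Qed.

End Truncation.

Section Continuous.
Variables (K : fieldType) (V : finType).

Definition lcont (Q Q' : quiver V) (phi : cpa K Q -> cpa K Q') : Prop :=
  [/\ {morph phi : f g / f + g}, (forall c, {morph phi : f / c *: f}) &
      forall N, exists M, forall f, inm M f -> inm N (phi f)].

Section Pair.
Variables (Q Q' : quiver V).
Implicit Types (phi psi : cpa K Q -> cpa K Q') (f g : cpa K Q).

Lemma lcont0 phi : lcont phi -> phi 0 = 0.
Proof. by case=> _ pZ _; rewrite -[X in phi X](scale0r 0) pZ scale0r. Qed.

Lemma lcontB phi f g : lcont phi -> phi (f - g) = phi f - phi g.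
Proof. by case=> pD pZ _; rewrite pD -scaleN1r pZ scaleN1r. Qed.

Lemma lcont_sum phi I (r : seq I) (P : pred I) F : lcont phi ->
  phi (\sum_(x <- r | P x) F x) = \sum_(x <- r | P x) phi (F x).
Proof. by move=> pc; apply: big_morph; [case: pc | exact: lcont0]. Qed.

Lemma lcont_add phi psi : lcont phi -> lcont psi -> lcont (fun f => phi f + psi f).
Proof.
move=> [pD pZ pc] [qD qZ qc]; split=> [f g|c f|N].
- by rewrite pD qD addrACA.
- by rewrite pZ qZ scalerDr.
have [[M hM] [M' hM']] := (pc N, qc N); exists (maxn M M') => f hf.
by apply: inmD; [apply: hM|apply: hM']; apply: inm_le hf; rewrite ?leq_maxl ?leq_maxr.
Qed.

Lemma lcont_opp phi : lcont phi -> lcont (fun f => - phi f).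
Proof.
move=> [pD pZ pc]; split=> [f g|c f|N]; rewrite ?pD ?opprD ?pZ ?scalerN //.
by have [M hM] := pc N; exists M => f /hM; exact: inmN.
Qed.

Lemma lcont_zero : lcont (fun _ : cpa K Q => 0 : cpa K Q').
Proof.
split=> [f g|c f|N]; rewrite ?addr0 ?scaler0 //.
by exists 0%N => f _; exact: inm_0.
Qed.

Lemma lcont_bigsum (I : Type) (r : seq I) (P : pred I) (F : I -> cpa K Q -> cpa K Q') :
  (forall x, P x -> lcont (F x)) ->
  lcont (fun f => \sum_(x <- r | P x) F x f).
Proof.
move=> h; elim: r => [|x r IH].
  by under [fun f => _]funext do rewrite big_nil; exact: lcont_zero.
under [fun f => _]funext do rewrite big_cons.
by have [px|px] := boolP (P x); [apply: lcont_add => //; apply: h|].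
Qed.

(** Truncations of [f] converge to [f], so density reduces the claim to monomials. Only words that
    occur in [f] need checking, so a condition such as [ev i * f = f] passes to each of them. *)
Lemma lcont_ind Z phi f : closed_sub Z -> lcont phi ->
  (forall w, is_word w -> ext f w != 0 -> Z (phi (mono K w))) -> Z (phi f).
Proof.
move=> cZ pc h; have [z0 zD zZ zc] := cZ; apply: zc => N.
have [pD pZ cont] := pc; have [M hM] := cont N.
exists (phi (\sum_(w <- words Q M) ext f w *: mono K w)); split; last first.
  by rewrite -lcontB //; apply/hM/inm_tr.
rewrite lcont_sum //; apply: closed_sum => // w _; rewrite pZ.
have [ww|ww] := boolP (is_word w); last by rewrite ext_out // scale0r.
by have [->|nz] := eqVneq (ext f w) 0; [rewrite scale0r | apply/zZ/h].
Qed.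

Lemma lcont_eq phi psi f : lcont phi -> lcont psi ->
  (forall w, is_word w -> ext f w != 0 -> phi (mono K w) = psi (mono K w)) ->
  phi f = psi f.
Proof.
move=> pc qc h; apply/eqP; rewrite -subr_eq0; apply/eqP.
apply: (lcont_ind (phi := fun f => phi f - psi f) (closed_sub0 K (Q'))).
  exact/lcont_add/lcont_opp.
by move=> w ww nz; rewrite h // subrr.
Qed.

End Pair.

Lemma lcont_id (Q : quiver V) : lcont (fun f : cpa K Q => f).
Proof. by split=> // N; exists N. Qed.

Lemma lcont_comp (Q Q' Q'' : quiver V) (phi : cpa K Q' -> cpa K Q'')
  (psi : cpa K Q -> cpa K Q') :
  lcont phi -> lcont psi -> lcont (fun f => phi (psi f)).
Proof.
move=> [pD pZ pc] [qD qZ qc]; split=> [f g|c f|N]; rewrite ?qD ?pD ?qZ ?pZ //.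
have [M hM] := pc N; have [M' hM'] := qc M; exists M' => f /hM'; exact: hM.
Qed.

Lemma lcont_mull (Q : quiver V) (g : cpa K Q) : lcont (fun f => g * f).
Proof.
split=> [f h|c f|N]; rewrite ?mulrDr ?cpaZr //.
by exists N => f; exact: inmMr.
Qed.

Lemma lcont_mulr (Q : quiver V) (g : cpa K Q) : lcont (fun f => f * g).
Proof.
split=> [f h|c f|N]; rewrite ?mulrDl ?cpaZl //.
by exists N => f; exact: inmMl.
Qed.

Lemma lcont_ldiv (Q : quiver V) (a : arr Q) : lcont (@ldiv K V Q a).
Proof.
split=> [f h|c f|N]; rewrite ?ldivD ?ldivZ //.
by exists N.+1 => f; exact: inm_ldiv.
Qed.

Lemma closed_preim (Q Q' : quiver V) Z (phi : cpa K Q -> cpa K Q') :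
  closed_sub Z -> lcont phi -> closed_sub (fun f => Z (phi f)).
Proof.
move=> [z0 zD zZ zc] pc; have [pD pZ cont] := pc.
split=> [|f g hf hg|c f hf|f h]; rewrite ?lcont0 ?pD ?pZ //; try by auto.
apply: zc => N; have [M hM] := cont N; have [g [zg hg]] := h M.
by exists (phi g); rewrite -lcontB //; split=> //; exact: hM.
Qed.

End Continuous.

(** * Algebra homomorphisms fixing the vertices, and their automatic continuity *)

Section Homs.
Variables (K : fieldType) (V : finType).

Record chom (Q Q' : quiver V) (phi : cpa K Q -> cpa K Q') : Prop := Chom {
  chom_lcont : lcont phi;
  chomM : {morph phi : f g / f * g};
  chom_ev : forall i, phi (ev K Q i) = ev K Q' i;
  chom_inm : forall N f, inm N f -> inm N (phi f) }.

Lemma mono_evl (Q : quiver V) i (s : seq (arr Q)) : ev K Q i * mono K (i, s) = mono K (i, s).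
Proof.
apply: cpaP => -[l t] _; rewrite ext_evM ext_mono xpair_eqE.
by case: (l =P i); rewrite ?mul1r ?mul0r.
Qed.

Lemma mono_cons (Q : quiver V) i a s : is_word (Q := Q) (i, a :: s) ->
  mono K (i, a :: s) = ar K a * mono K (tl a, s).
Proof. by rewrite is_word_cons ar_mono eqxx => /andP[/eqP->]. Qed.

Lemma mono_ar (Q : quiver V) i (s : seq (arr Q)) a : is_word (i, s) ->
  mono K (i, s) * ar K a =
  if wtail (i, s) == hd a then mono K (i, rcons s a) else 0.
Proof.
elim: s i => [|b s IH] i w.
  rewrite mono_nil -[wtail _]/i; case: eqP => [->|n]; first exact: evl_ar.
  by rewrite -evl_ar mulrA evM; case: eqP => //; rewrite mul0r.
have := w; rewrite mono_cons // is_word_cons => /andP[/eqP -> h].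
rewrite -mulrA IH // wtail_cons; case: eqP => e; last by rewrite mulr0.
by rewrite rcons_cons mono_cons // is_word_cons eqxx is_word_rcons h e eqxx.
Qed.

Lemma chom_eq (Q Q' : quiver V) (phi psi : cpa K Q -> cpa K Q') :
  chom phi -> chom psi -> (forall a, phi (ar K a) = psi (ar K a)) ->
  forall f, phi f = psi f.
Proof.
move=> [pc pM pe _] [qc qM qe _] h f; apply: lcont_eq => // -[i s] w _.
elim: s i w => [|a s IH] i w; first by rewrite mono_nil pe qe.
rewrite mono_cons // pM qM h IH //.
by move: w; rewrite is_word_cons => /andP[].
Qed.

Lemma chom_id (Q : quiver V) : chom (fun f : cpa K Q => f).
Proof. by split=> //; exact: lcont_id. Qed.

Lemma chom_comp (Q Q' Q'' : quiver V) (phi : cpa K Q' -> cpa K Q'')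
  (psi : cpa K Q -> cpa K Q') :
  chom phi -> chom psi -> chom (fun f => phi (psi f)).
Proof.
move=> [pc pM pe pI] [qc qM qe qI]; split=> [|f g|i|N f].
- exact: lcont_comp.
- by rewrite qM pM.
- by rewrite qe pe.
- by move/qI/pI.
Qed.

Lemma inm_exp (Q : quiver V) (f : cpa K Q) n : inm 1 f -> inm n (f ^+ n).
Proof.
move=> h; elim: n => // n IH; rewrite exprS -add1n; exact: inmM.
Qed.

Lemma one_sub_inv (Q : quiver V) (x : cpa K Q) : inm 1 x -> exists y, (1 - x) * y = 1.
Proof.
move=> hx; pose S N := \sum_(n < N) x ^+ n.
(* The geometric series: x^n has no term at [p] once [n] exceeds the length of [p], so this partial
   sum already gives the limit coefficient. *)
pose y : cpa K Q := fun p => S (plen p).+1 p; exists y.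
apply/eqP; rewrite -subr_eq0; apply/eqP/inm_inf => N.
have hy : inm N (y - S N).
  move=> v lt; rewrite extB; have [w|w] := boolP (is_word v); last by rewrite !ext_out ?subr0.
  rewrite {1}(ext_in _ w) {1}/y -ext_val /plen /= /S !ext_sum.
  rewrite -!(big_mkord xpredT (fun n => ext (x ^+ n) v)).
  rewrite (big_cat_nat (n := (size v.2).+1) (p := N)) //= opprD addNKr.
  rewrite big_nat big1 ?oppr0 // => n /andP[le _].
  exact: (inm_exp (n := n) hx).
have -> : (1 - x) * y - 1 = (1 - x) * (y - S N) - x ^+ N.
  rewrite mulrBr -addrA; congr (_ + _).
  by rewrite -mulNr opprB -subrX1 addrAC subrr add0r.
by apply: inmB; [apply: inmMr | apply: inm_exp].
Qed.

(** Automatic continuity. Suppose [g] is in the arrow ideal but [phi g] has constant term r != 0 at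
    a vertex i. Then 1 - r^-1 g is invertible, while its image has constant term 0 at i, a
    contradiction. Hence [phi] preserves the arrow ideal, and peeling off one arrow at a time gives
    all its powers. *)
Lemma chom_unital (Q Q' : quiver V) (phi : cpa K Q -> cpa K Q') :
  {morph phi : f g / f + g} -> (forall c, {morph phi : f / c *: f}) ->
  {morph phi : f g / f * g} -> (forall i, phi (ev K Q i) = ev K Q' i) -> chom phi.
Proof.
move=> pD pZ pM pe.
have p0 : phi 0 = 0 by rewrite -[X in phi X](scale0r 0) pZ scale0r.
have pS I (r : seq I) P F : phi (\sum_(x <- r | P x) F x) = \sum_(x <- r | P x) phi (F x).
  exact: big_morph.
have p1 : phi 1 = 1 by rewrite -!sum_ev pS; apply: eq_bigr.
have pI N f : inm N f -> inm N (phi f).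
  elim: N f => // N IH f hf; have h1 := inm_le (ltn0Sn N) hf.
  have q1 g : inm 1 g -> inm 1 (phi g).
    move=> hg [i [|? ?]] // _; apply/eqP/negPn/negP => nz.
    set r := ext _ _ in nz.
    have [y] := one_sub_inv (inmZ r^-1 hg) => /(congr1 phi).
    rewrite pM -scaleN1r pD !pZ p1 => /(congr1 (fun f => ext f (i, [::]))).
    rewrite ext_mul_nil extD !extZ -/r ext_emb mulVf // mulr1 subrr mul0r => /eqP.
    by rewrite eq_sym oner_eq0.
  rewrite (ldiv_sum h1) pS; apply: inm_sum => a _; rewrite pM -add1n.
  by apply: inmM; [apply/q1/inm_ar | apply/IH/inm_ldiv].
by split=> //; split=> // N; exists N; exact: pI.
Qed.

End Homs.

(** * Substitution homomorphisms prescribed on the arrows *)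

Section Lift.
Variables (K : fieldType) (V : finType) (Q Q' : quiver V).
Variable rho : arr Q -> cpa K Q'.
Hypothesis rho_l : forall a, ev K Q' (hd a) * rho a = rho a.
Hypothesis rho_r : forall a, rho a * ev K Q' (tl a) = rho a.
Hypothesis rho_m : forall a, inm 1 (rho a).

Definition wprod (w : V * seq (arr Q)) : cpa K Q' :=
  ev K Q' w.1 * \prod_(a <- w.2) rho a.

(** Since each [rho a] lies in the arrow ideal, a word longer than [p] cannot contribute at [p]; the
    infinite substitution is therefore a finite sum at every coefficient. *)
Definition lift_hom (f : cpa K Q) : cpa K Q' := fun p =>
  (\sum_(w <- words Q (plen p).+1) ext f w *: wprod w : cpa K Q') p.

Lemma ext_lift f v : ext (lift_hom f) v =
  \sum_(w <- words Q (size v.2).+1) ext f w * ext (wprod w) v.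
Proof.
have [h|h] := boolP (is_word v); last first.
  by rewrite ext_out // big1 // => w _; rewrite (ext_out (wprod w)) ?mulr0.
rewrite (ext_in _ h) /lift_hom -ext_val /plen /= ext_sum.
by apply: eq_bigr => w _; rewrite extZ.
Qed.

Lemma inm_wprod w : inm (size w.2) (wprod w).
Proof.
apply: inmMr; case: w => _ s /=; elim: s => [|a s IH]; first exact: inm0n.
by rewrite big_cons -[size _]add1n; apply: inmM.
Qed.

Lemma inm_lift_tr N f : inm N (lift_hom f - \sum_(w <- words Q N) ext f w *: wprod w).
Proof.
move=> v lt; rewrite extB ext_lift ext_sum; apply/eqP; rewrite subr_eq0; apply/eqP.
under [RHS]eq_bigr do rewrite extZ.
rewrite [RHS](bigID (fun w => w \in words Q (size v.2).+1)) /= [X in _ + X]big1 ?addr0.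
  rewrite -[RHS]big_filter; apply/perm_big/uniq_perm; rewrite ?filter_uniq ?words_uniq //.
  by move=> w; rewrite mem_filter !mem_words; lia.
by move=> w; rewrite mem_words -leqNgt => h; rewrite inm_wprod ?mulr0.
Qed.

Lemma lift_lcont : lcont lift_hom.
Proof.
split=> [f g|c f|N].
- apply: cpaP => v _; rewrite extD !ext_lift -big_split /=.
  by apply: eq_bigr => w _; rewrite extD mulrDl.
- apply: cpaP => v _; rewrite extZ !ext_lift mulr_sumr.
  by apply: eq_bigr => w _; rewrite extZ mulrA.
exists N => f hf v lt; rewrite ext_lift big_seq big1 // => w.
by rewrite mem_words => le; rewrite hf ?mul0r // (leq_trans le).
Qed.

Lemma lift_mono w : is_word w -> lift_hom (mono K w) = wprod w.
Proof.
move=> h; apply/eqP; rewrite -subr_eq0; apply/eqP/inm_inf => N.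
(* The cutoff exceeds the length of [w], so that [w] itself occurs in the truncated sum. *)
have := @inm_lift_tr (N + (size w.2).+1) (mono K w).
have lt : (size w.2 < N + (size w.2).+1)%N by lia.
rewrite (bigD1_seq w) ?words_uniq ?mem_words //=.
rewrite ext_mono eqxx h scale1r big1 ?addr0 => [|v n].
  by move=> h1; apply: inm_le h1; lia.
by rewrite ext_mono (negbTE n) scale0r.
Qed.

Lemma wprod_cons i a s : wprod (i, a :: s) = ev K Q' i * rho a * wprod (tl a, s).
Proof. by rewrite /wprod /= big_cons !mulrA -[_ * ev K Q' (tl a)]mulrA rho_r. Qed.

Lemma lift_ar a : lift_hom (ar K a) = rho a.
Proof.
rewrite lift_mono ?is_word_cons ?eqxx // wprod_cons rho_l.
by rewrite /wprod big_nil mulr1 rho_r.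
Qed.

Lemma lift_ev i : lift_hom (ev K Q i) = ev K Q' i.
Proof. by rewrite -mono_nil lift_mono // /wprod big_nil mulr1. Qed.

Lemma lift_arM a g : lift_hom (ar K a * g) = rho a * lift_hom g.
Proof.
have lc := lift_lcont.
apply: (lcont_eq (phi := fun g => lift_hom (ar K a * g)) (psi := fun g => rho a * lift_hom g)).
- exact/lcont_comp/lcont_mull.
- exact/(lcont_comp (lcont_mull _)).
move=> [i s] w _; rewrite ar_mono lift_mono //; case: eqP => [e|n].
  rewrite lift_mono ?is_word_cons ?eqxx -?e // wprod_cons rho_l.
  by rewrite e.
have e0 : ev K Q' (tl a) * ev K Q' i = 0 by rewrite evM; case: eqP => // e; case: n.
by rewrite lcont0 // /wprod mulrA -[rho a]rho_r -[_ * ev _ _ i]mulrA e0 mulr0 mul0r.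
Qed.

Lemma lift_evM i g : lift_hom (ev K Q i * g) = ev K Q' i * lift_hom g.
Proof.
have lc := lift_lcont.
apply: (lcont_eq (phi := fun g => lift_hom (ev K Q i * g))
  (psi := fun g => ev K Q' i * lift_hom g)).
- exact/lcont_comp/lcont_mull.
- exact/(lcont_comp (lcont_mull _)).
move=> [j s] w _; rewrite -mono_evl mulrA evM; case: eqP => [->|n].
  by rewrite mono_evl lift_mono // /wprod mulrA evM eqxx.
rewrite mul0r lcont0 // mono_evl lift_mono // /wprod mulrA evM.
by case: eqP => //; rewrite mul0r.
Qed.

(** By density the left factor may be taken to be a path, which is then removed arrow by arrow with
    [lift_arM], ending at [lift_evM]. *)
Lemma liftM : {morph lift_hom : f g / f * g}.
Proof.
have lc := lift_lcont; move=> f g.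
apply: (lcont_eq (phi := fun f => lift_hom (f * g)) (psi := fun f => lift_hom f * lift_hom g)).
- exact/lcont_comp/lcont_mulr.
- exact/(lcont_comp (lcont_mulr _)).
move=> [i s] w _; elim: s i w => [|a s IH] i w.
  by rewrite mono_nil lift_evM lift_ev.
rewrite mono_cons // -mulrA !lift_arM IH ?mulrA //.
by move: w; rewrite is_word_cons => /andP[].
Qed.

Lemma lift_chom : chom lift_hom.
Proof.
apply: chom_unital; [by case: lift_lcont | by case: lift_lcont | exact: liftM | ].
exact: lift_ev.
Qed.

End Lift.

(** * Cyclic equivalence *)

Section Commutators.
Variables (K : fieldType) (V : finType) (Q : quiver V).
Implicit Types (f g h : cpa K Q).

(** Passing to differences turns cyclic equivalence into membership in a closed subspace, to which
    the density arguments apply. *)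
Definition csim0 h : Prop := cyc_equiv h 0.

Lemma csim0E f g : cyc_equiv f g <-> csim0 (f - g).
Proof.
have e q : f q - g q = (f - g) q - (0 : cpa K Q) q by rewrite subr0.
by split=> h n; have [l [cl hl]] := h n; exists l; split=> // q lt; rewrite -hl ?e.
Qed.

Lemma csim0_closed : closed_sub csim0.
Proof.
split=> [n|f g hf hg n|c f hf n|f h n].
- by exists [::]; split=> // q _; rewrite subr0 /spanval big_nil.
- have [[l [cl hl]] [m [cm hm]]] := (hf n, hg n); exists (l ++ m).
  rewrite all_cat cl cm; split=> // q lt.
  by rewrite /spanval big_cat /= -/(spanval l q) -/(spanval m q) -hl // -hm // !subr0.
- have [l [cl hl]] := hf n; exists [seq (c * x.1, x.2) | x <- l].
  rewrite all_map; split=> // q lt; rewrite /spanval big_map subr0.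
  under eq_bigr do rewrite /= -mulrA.
  by rewrite -mulr_sumr -/(spanval l q) -hl // subr0.
have [g [zg hg]] := h n; have [l [cl hl]] := zg n; exists l; split=> // q lt.
rewrite -hl // !subr0; apply/eqP; rewrite -subr_eq0; apply/eqP.
by rewrite -[RHS](hg (sval q)) // ext_val.
Qed.

Lemma csim0_rot (p : pth Q) : cyclic p ->
  csim0 (mono K (sval p) - mono K (rotw (sval p))).
Proof.
move=> cp n; exists [:: (1, p)]; rewrite /= cp; split=> // q _.
by rewrite /spanval big_seq1 mul1r subr0.
Qed.

(** Elimination principle: the cyclically trivial elements form the least closed subspace containing
    all rotation differences. Given cyclic equivalences are exploited through it. *)
Lemma csim0_min (Z : cpa K Q -> Prop) : closed_sub Z ->
  (forall p : pth Q, cyclic p -> Z (mono K (sval p) - mono K (rotw (sval p)))) ->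
  forall h, csim0 h -> Z h.
Proof.
move=> cZ zr h hh; have [_ _ zZ zc] := cZ; apply: zc => N.
have [l [cl hl]] := hh N.
exists (\sum_(x <- l | cyclic x.2) x.1 *: (mono K (sval x.2) - mono K (rotw (sval x.2)))).
split; first by apply: closed_sum => // x cx; apply/zZ/zr.
move=> v lt; have [w|w] := boolP (is_word v); last by rewrite ext_out.
rewrite extB ext_sum -big_filter (all_filterP cl) (ext_in _ w).
have := hl (exist _ v w) lt; rewrite subr0 => ->; rewrite /spanval.
apply/eqP; rewrite subr_eq0; apply/eqP/eq_bigr => x _.
by rewrite -[v]/(sval (exist (fun w => is_word w) v w)) ext_val.
Qed.

Lemma csim0_ar a (y : cpa K Q) : ev K Q (tl a) * y = y -> y * ev K Q (hd a) = y ->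
  csim0 (ar K a * y - y * ar K a).
Proof.
move=> yl yr; apply: (lcont_ind (phi := fun y => ar K a * y - y * ar K a) csim0_closed).
  by apply/lcont_add/lcont_opp; [exact: lcont_mull | exact: lcont_mulr].
move=> [i s] w nz.
have ei : i == tl a.
  by apply/negPn/negP => n; move: nz; rewrite -yl ext_evM (negbTE n) mul0r eqxx.
have ej : wtail (i, s) == hd a.
  by apply/negPn/negP => n; move: nz; rewrite -yr ext_Mev (negbTE n) mulr0 eqxx.
rewrite ar_mono mono_ar // ei ej.
have ww : is_word (hd a, a :: s) by rewrite is_word_cons eqxx -(eqP ei).
have -> : mono K (i, rcons s a) = mono K (rotw (hd a, a :: s)).
  congr (mono K (_, _)); rewrite (eqP ei).
  case: s w ej {nz ww} => [|b s] w ej; first by rewrite -(eqP ei) /= -(eqP ej).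
  by move: w; rewrite is_word_cons (eqP ei) => /andP[/eqP].
apply: (@csim0_rot (exist (fun w => is_word w) _ ww)).
by rewrite /cyclic /cyclicw /= wtail_cons -(eqP ei) eq_sym ej.
Qed.

Lemma csim0_comm i j f g :
  ev K Q i * f = f -> f * ev K Q j = f -> ev K Q j * g = g -> g * ev K Q i = g ->
  csim0 (f * g - g * f).
Proof.
move=> fl fr gl gr.
apply: (lcont_ind (phi := fun f => f * g - g * f) csim0_closed).
  by apply/lcont_add/lcont_opp; [exact: lcont_mulr | exact: lcont_mull].
move=> [l s] w nz.
have el : l = i.
  by apply/eqP/negPn/negP => n; move: nz; rewrite -fl ext_evM (negbTE n) mul0r eqxx.
have ej : wtail (l, s) = j.
  by apply/eqP/negPn/negP => n; move: nz; rewrite -fr ext_Mev (negbTE n) mulr0 eqxx.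
(* What remains concerns one path against arbitrary [g]. The induction must keep [l] and [g]
   general, because removing the first arrow [a] replaces [g] by [g * ar K a]. *)
rewrite -el in gr; move: w ej gl gr; clear.
elim: s l g => [|a s IH] l g w wt gl gr.
  by rewrite -wt in gl; rewrite mono_nil gl gr subrr; case: csim0_closed.
have := w; rewrite mono_cons // is_word_cons => /andP[/eqP e w1].
rewrite e in gr; have := mono_evl K (tl a) s; set m := mono _ _ => ml.
rewrite -mulrA [g * (_ * _)]mulrA.
(* The arrow is moved to the end first, then the rest [m] of the path. *)
have -> : ar K a * (m * g) - g * ar K a * m =
    (ar K a * (m * g) - m * g * ar K a) + (m * (g * ar K a) - g * ar K a * m).
  by rewrite addrA -[m * g * _]mulrA subrK.
have [_ cD _ _] := csim0_closed; apply: cD.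
  by apply: csim0_ar; rewrite -?mulrA ?gr // mulrA ml.
apply: IH => //; first by rewrite -wt wtail_cons.
  by rewrite mulrA gl.
by rewrite -mulrA evr_ar.
Qed.

End Commutators.

(** * Brackets *)

Section Bracket.
Variables (K : fieldType) (V : finType) (k : V) (Q : quiver V).
Hypothesis no_loop : forall a : arr Q, hd a != tl a.
Local Notation Qt := (mut_quiver Q k).
Local Notation beta := (@bracketS K V Q k).
Local Notation unsub t := (unsubstw (map (@sval _ _) t)).
Implicit Types (f g h : cpa K Q) (a b c : arr Q) (i j : V) (t : seq (arr Qt)).

(** Total on letters, with value 0 on invalid ones, so that sums over dual arrows carry no validity
    proofs. *)
Definition lar (x : letter Q) : cpa K Qt :=
  oapp (fun y : mut_arr Q k => @ar K V Qt y) 0 (insub x).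

Lemma larE (x : arr Qt) : lar (sval x) = ar K x.
Proof. by rewrite /lar (valK x). Qed.

Lemma lar_l x : ev K Qt (hd_letter x) * lar x = lar x.
Proof.
rewrite /lar; case: insubP => [y _ <-|_] /=; last by rewrite mulr0.
exact: (evl_ar K (y : arr Qt)).
Qed.

Lemma lar_r x : lar x * ev K Qt (tl_letter x) = lar x.
Proof.
rewrite /lar; case: insubP => [y _ <-|_] /=; last by rewrite mul0r.
exact: (evr_ar K (y : arr Qt)).
Qed.

Lemma star_l c : tl c == k -> ev K Qt k * lar (inr c) = lar (inr c).
Proof. by move/eqP=> e; have := lar_l (inr c); rewrite /= e. Qed.

Lemma star_r c : hd c == k -> lar (inr c) * ev K Qt k = lar (inr c).
Proof. by move/eqP=> e; have := lar_r (inr c); rewrite /= e. Qed.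

Lemma inm_lar x : inm 1 (lar x).
Proof.
by rewrite /lar; case: insubP => [y _ _|_] /=; [exact: inm_ar | exact: inm_0].
Qed.

Definition rhoU (x : arr Qt) : cpa K Q :=
  match sval x with
  | inl (inl a) => ar K a
  | inl (inr (a, b)) => ar K b * ar K a
  | inr _ => 0
  end.

Lemma rhoU_l x : ev K Q (hd x) * rhoU x = rhoU x.
Proof.
by case: x => [[[a|[a b]]|c] v]; rewrite /rhoU /= ?evl_ar ?mulr0 // mulrA evl_ar.
Qed.

Lemma rhoU_r x : rhoU x * ev K Q (tl x) = rhoU x.
Proof.
by case: x => [[[a|[a b]]|c] v]; rewrite /rhoU /= ?evr_ar ?mul0r // -mulrA evr_ar.
Qed.

Lemma inm_rhoU x : inm 1 (rhoU x).
Proof.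
case: x => [[[a|[a b]]|c] v]; rewrite /rhoU /=; first exact: inm_ar.
  by apply: inmMl; exact: inm_ar.
exact: inm_0.
Qed.

(* Expands [ba] back into the product ba and kills the dual arrows. *)
Definition unbr := lift_hom rhoU.
Let unbr_chom : chom unbr := lift_chom rhoU_l rhoU_r inm_rhoU.

Definition rhoP (x : arr Qt) : cpa K Qt :=
  if sval x is inl _ then ar K x else 0.

Lemma rhoP_l x : ev K Qt (hd x) * rhoP x = rhoP x.
Proof. by rewrite /rhoP; case: (sval x) => _; rewrite ?evl_ar ?mulr0. Qed.

Lemma rhoP_r x : rhoP x * ev K Qt (tl x) = rhoP x.
Proof. by rewrite /rhoP; case: (sval x) => _; rewrite ?evr_ar ?mul0r. Qed.

Lemma inm_rhoP x : inm 1 (rhoP x).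
Proof. by rewrite /rhoP; case: (sval x) => _; [exact: inm_ar | exact: inm_0]. Qed.

(** The projection that kills the dual arrows. It is the composite of [unbr] with the bracket
    ([beta_unbr]), and being a homomorphism it makes up for the bracket not being one. *)
Definition nostar := lift_hom rhoP.
Let nostar_chom : chom nostar := lift_chom rhoP_l rhoP_r inm_rhoP.

Lemma unsubst_cons_inv (x : arr Qt) t s : unsub (x :: t) = Some s ->
  exists s', unsub t = Some s' /\
  ((exists a, sval x = inl (inl a) /\ s = a :: s') \/
   (exists a b, sval x = inl (inr (a, b)) /\ s = b :: a :: s')).
Proof.
case: x => [[[a|[a b]]|c] v] //=; case e: (unsub t) => [s'|] //= [<-].
  by exists s'; split=> //; left; exists a.
by exists s'; split=> //; right; exists a, b.
Qed.

(** The left-to-right scan of [substw] makes no wrong choice: a valid unbracketed letter has no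
    endpoint at [k], while in [ba] the arrow [b] starts at [k] and forces the pairing. Thus the test
    inside [bracketS] always succeeds ([ext_beta]). *)
Lemma unsubstK t s : unsub t = Some s -> substw k s = Some (map (@sval _ _) t).
Proof.
elim: t s => [|x t IH] s; first by case=> <-.
case/unsubst_cons_inv => s' [/IH {}IH [[a [e ->]]|[a [b [e ->]]]]].
  by rewrite /=; have := valP x; rewrite /= e /= IH => ->.
by rewrite /=; have := valP x; rewrite /= e IH => /= /andP[-> ->]; rewrite andbF.
Qed.

Lemma unsubst_inj t t' s : unsub t = Some s -> unsub t' = Some s -> t = t'.
Proof. by move/unsubstK => e /unsubstK; rewrite e => -[/(inj_map val_inj)]. Qed.

Lemma size_unsubst t s : unsub t = Some s -> (size s <= (size t).*2)%N.
Proof.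
elim: t s => [|x t IH] s; first by case=> <-.
case/unsubst_cons_inv => s' [/IH {}IH [[a [_ ->]]|[a [b [_ ->]]]]];
  by rewrite [size (_ :: _)]/= doubleS !ltnS // leqW.
Qed.

Lemma is_word_unsubst i t s :
  is_word (i, t) -> unsub t = Some s -> is_word (Q := Q) (i, s).
Proof.
elim: t i s => [|x t IH] i s; first by move=> _ [<-].
rewrite is_word_cons => /andP[/eqP -> w] /unsubst_cons_inv.
case=> s' [/(IH _ _ w) {}IH [[a [e ->]]|[a [b [e ->]]]]].
  by rewrite is_word_cons /= e /= eqxx; move: IH; rewrite /= e.
rewrite !is_word_cons /= e /= eqxx; move: IH; rewrite /= e /= => ->.
by have := valP x; rewrite /= e => /= /andP[/eqP-> /eqP->]; rewrite eqxx.
Qed.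

Lemma wprod_unbr i t : is_word (i, t) ->
  wprod rhoU (i, t) = oapp (fun s => mono K (i, s)) 0 (unsub t).
Proof.
elim: t i => [|x t IH] i; first by rewrite /wprod big_nil mulr1 /= mono_nil.
rewrite is_word_cons => /andP[/eqP -> w].
rewrite (wprod_cons rhoU_r) IH // rhoU_l.
case: x w {IH} => [[[a|[a b]]|c] v] w; rewrite /rhoU /=; last by rewrite mul0r.
  by case: (unsub t) => [s|] /=; rewrite ?mulr0 // ar_mono eqxx.
case: (unsub t) => [s|] /=; rewrite ?mulr0 // -mulrA !ar_mono eqxx ar_mono.
by have := v => /= /andP[/eqP-> /eqP->]; rewrite eqxx.
Qed.

Lemma ext_beta f i t : is_word (i, t) ->
  ext (beta f) (i, t) = oapp (fun s => ext f (i, s)) 0 (unsub t).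
Proof.
move=> w; rewrite (ext_in _ w) /bracketS /=.
by case e: (unsub t) => [s|] //=; rewrite (unsubstK e) eqxx.
Qed.

(** A letter absorbs at most two arrows, hence the factor 2. *)
Lemma beta_inm N f : inm N.*2 f -> inm N (beta f).
Proof.
move=> h [i t] lt; have [w|w] := boolP (is_word (i, t)); last by rewrite ext_out.
rewrite ext_beta //; case e: (unsub t) => [s|] //=; apply: h.
by have := size_unsubst e; rewrite /= in lt *; lia.
Qed.

Lemma beta_inm1 f : inm 1 f -> inm 1 (beta f).
Proof. by move=> h [i [|x t]] // _; rewrite ext_beta //= h. Qed.

Lemma beta_lcont : lcont beta.
Proof.
split=> [f g|c f|N]; last by exists N.*2 => f; exact: beta_inm.
  apply: cpaP => -[i t] w; rewrite extD !ext_beta //.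
  by case: (unsub t) => [s|] /=; rewrite ?extD ?addr0.
apply: cpaP => -[i t] w; rewrite extZ !ext_beta //.
by case: (unsub t) => [s|] /=; rewrite ?extZ ?mulr0.
Qed.

Lemma beta_mono i t s : is_word (i, t) -> unsub t = Some s ->
  beta (mono K (i, s)) = mono K (i, t).
Proof.
move=> w e; apply: cpaP => -[j t'] w'; rewrite ext_beta // ext_mono w andbT.
case e': (unsub t') => [s'|] /=; last first.
  by case: eqP => // -[_ et]; move: e'; rewrite et e.
rewrite ext_mono (is_word_unsubst w e) andbT !xpair_eqE; congr ((nat_of_bool (_ && _))%:R).
apply/eqP/eqP => [es|et]; last by move: e'; rewrite et e => -[].
by apply: unsubst_inj e' _; rewrite e es.
Qed.

Lemma beta_ev i : beta (ev K Q i) = ev K Qt i.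
Proof. by rewrite -!mono_nil (@beta_mono i [::] [::]). Qed.

(** Every passage through [k] is interior and can be bracketed. Absence of loops guarantees that
    after [ba] the scan resumes at a vertex other than [k]. The induction is on a size bound because
    two arrows may be consumed at once. *)
Lemma subst_exists i (s : seq (arr Q)) : is_word (i, s) -> i != k ->
  wtail (i, s) != k -> exists t, is_word (i, t) /\ unsub t = Some s.
Proof.
have [n] := ubnP (size s); elim: n i s => // n IH i [|b s] /= lt w nk wk.
  by exists [::].
move: w; rewrite is_word_cons => /andP[/eqP ei w]; rewrite wtail_cons in wk.
have [eb|nb] := eqVneq (tl b) k; last first.
  have [t [wt et]] := IH _ _ lt w nb wk.
  have v : valid_letter k (inl (inl b) : letter Q) by rewrite /= -ei nk nb.
  by exists ((exist (fun x : letter Q => valid_letter k x) _ v : arr Qt) :: t);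
    rewrite is_word_cons ei eqxx wt /= et.
case: s lt w wk => [|a s] /= lt w wk; first by rewrite /wtail /= eb eqxx in wk.
move: w; rewrite is_word_cons => /andP[/eqP ea w]; rewrite wtail_cons in wk.
have na : tl a != k by rewrite -eb ea eq_sym no_loop.
have [t [wt et]] := IH _ _ (ltnW lt) w na wk.
have v : valid_letter k (inl (inr (a, b)) : letter Q) by rewrite /= -ea eb eqxx.
by exists ((exist (fun x : letter Q => valid_letter k x) _ v : arr Qt) :: t);
    rewrite is_word_cons ei eqxx wt /= et.
Qed.

Lemma beta_unbr (f : cpa K Qt) : beta (unbr f) = nostar f.
Proof.
apply: (lcont_eq (phi := fun x => beta (unbr x)) (psi := nostar)).
- exact/(lcont_comp beta_lcont)/chom_lcont.
- exact: chom_lcont.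
move=> [i t] w _; rewrite /unbr /nostar !lift_mono //; try exact: inm_rhoU;
  try exact: inm_rhoP.
rewrite wprod_unbr //.
have -> : wprod rhoP (i, t) = if unsub t is Some _ then mono K (i, t) else 0.
  elim: t i w => [|x t IH] i w; first by rewrite /wprod big_nil mulr1 /= mono_nil.
  rewrite (wprod_cons rhoP_r); move: w; rewrite is_word_cons => /andP[/eqP -> w].
  rewrite rhoP_l IH //; case: x w {IH} => [[[a|[a b]]|c] v] w;
    rewrite /rhoP /= ?mul0r //;
    by case: (unsub t) => [s|] /=; rewrite ?mulr0 // ar_mono eqxx.
case e: (unsub t) => [s|] /=; last by rewrite lcont0 //; exact: beta_lcont.
exact: beta_mono.
Qed.

(** Membership in (1 - e_k) R<<A>> (1 - e_k), where the bracket loses nothing. *)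
Definition corner f : Prop := ev K Q k * f = 0 /\ f * ev K Q k = 0.

Lemma evk0 i : i != k -> ev K Q k * ev K Q i = 0.
Proof. by rewrite eq_sym evM => /negbTE ->. Qed.

Lemma ev0k i : i != k -> ev K Q i * ev K Q k = 0.
Proof. by rewrite evM => /negbTE ->. Qed.

Lemma cornerP i j f : i != k -> j != k -> ev K Q i * f = f -> f * ev K Q j = f ->
  corner f.
Proof.
move=> ni nj el er; split; first by rewrite -el mulrA evk0 ?mul0r.
by rewrite -er -mulrA ev0k ?mulr0.
Qed.

Lemma corner_ev i : i != k -> corner (ev K Q i).
Proof. by move=> n; split; [exact: evk0|exact: ev0k]. Qed.

Lemma unbr_beta f : corner f -> unbr (beta f) = f.
Proof.
move=> [cl cr]; apply: (lcont_eq (phi := fun f => unbr (beta f)) (psi := id)).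
- by apply: lcont_comp beta_lcont; exact: chom_lcont.
- exact: lcont_id.
move=> [i s] w nz; have [||t [wt et]] := subst_exists w.
- apply/eqP => e; move/eqP: nz; apply.
  by have := congr1 (fun x => ext x (i, s)) cl; rewrite ext_evM e eqxx mul1r ext0.
- apply/eqP => e; move/eqP: nz; apply.
  by have := congr1 (fun x => ext x (i, s)) cr; rewrite ext_Mev e eqxx mulr1 ext0.
rewrite (beta_mono wt et) /unbr lift_mono //; last exact: inm_rhoU.
by rewrite wprod_unbr // et.
Qed.

Lemma nostar_beta f : corner f -> nostar (beta f) = beta f.
Proof. by move=> c; rewrite -beta_unbr unbr_beta. Qed.

(** Both brackets are fixed by [nostar], hence so is their product, and [nostar] is the bracket
    after [unbr]. Since [unbr] is a homomorphism that undoes the bracket on the corner, the product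
    is the bracket of [f * g]. *)
Lemma betaM f g : corner f -> corner g -> beta (f * g) = beta f * beta g.
Proof.
move=> cf cg; rewrite -(nostar_beta cf) -(nostar_beta cg).
by rewrite -(chomM nostar_chom) -beta_unbr (chomM unbr_chom) !unbr_beta.
Qed.

Lemma beta_evl i f : i != k -> corner f -> ev K Q i * f = f ->
  ev K Qt i * beta f = beta f.
Proof. by move=> n c e; rewrite -beta_ev -betaM ?e //; exact: corner_ev. Qed.

Lemma beta_evr i f : i != k -> corner f -> f * ev K Q i = f ->
  beta f * ev K Qt i = beta f.
Proof. by move=> n c e; rewrite -beta_ev -betaM ?e //; exact: corner_ev. Qed.

Lemma unbr_ar x : unbr (ar K x) = rhoU x.
Proof. exact: (lift_ar rhoU_l rhoU_r inm_rhoU). Qed.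

Lemma nostar_ar x : nostar (ar K x) = rhoP x.
Proof. exact: (lift_ar rhoP_l rhoP_r inm_rhoP). Qed.

Lemma unbr_star c : unbr (lar (inr c)) = 0.
Proof.
rewrite /lar; case: insubP => [y _ ey|_] /=; last exact/lcont0/chom_lcont.
by rewrite unbr_ar /rhoU ey.
Qed.

Lemma nostar_star c : nostar (lar (inr c)) = 0.
Proof. by rewrite -beta_unbr unbr_star lcont0 //; exact: beta_lcont. Qed.

Lemma lar_comp a b : hd a = k -> tl b = k -> lar (inl (inr (a, b))) = beta (ar K b * ar K a).
Proof.
move=> ha tb.
have v : valid_letter k (inl (inr (a, b)) : letter Q) by rewrite /= ha tb eqxx.
rewrite /lar insubT /=.
have := beta_unbr (@ar K V Qt (exist (fun x : letter Q => valid_letter k x) _ v)).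
by rewrite unbr_ar nostar_ar /rhoU /rhoP /= => ->.
Qed.

(** Distinct pairs (a, b) give distinct paths [ba] a^* b^*, so the indicator function in the
    definition equals the sum, each path counted once. *)
Lemma trianglesE : @triangles K V Q k =
  \sum_(a | hd a == k) \sum_(b | tl b == k)
    lar (inl (inr (a, b))) * lar (inr a) * lar (inr b) :> cpa K Qt.
Proof.
have E a b : hd a == k -> tl b == k -> exists t : seq (arr Qt),
   [/\ map (@sval _ _) t = [:: inl (inr (a, b)); inr a; inr b], is_word (hd b, t) &
    lar (inl (inr (a, b))) * lar (inr a) * lar (inr b) = mono K (hd b, t)].
  move=> ha tb.
  have v1 : valid_letter k (inl (inr (a, b)) : letter Q) by rewrite /= ha tb.
  have v2 : valid_letter k (inr a : letter Q) by rewrite /= ha.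
  have v3 : valid_letter k (inr b : letter Q) by rewrite /= tb orbT.
  pose x1 : arr Qt := exist (fun x : letter Q => valid_letter k x) _ v1.
  pose x2 : arr Qt := exist (fun x : letter Q => valid_letter k x) _ v2.
  pose x3 : arr Qt := exist (fun x : letter Q => valid_letter k x) _ v3.
  have w : is_word (hd b, [:: x1; x2; x3]).
    by rewrite !is_word_cons /= (eqP ha) (eqP tb) !eqxx.
  exists [:: x1; x2; x3]; split=> //.
  move: w; rewrite -[inl _]/(sval x1) -[inr a]/(sval x2) -[inr b]/(sval x3) !larE.
  rewrite is_word_cons => /andP[h1 w]; rewrite mono_cons ?is_word_cons ?h1 //.
  move: w; rewrite is_word_cons => /andP[h2 w]; rewrite mono_cons ?is_word_cons ?h2 //.
  move: w; rewrite is_word_cons => /andP[h3 w]; rewrite mono_cons ?is_word_cons ?h3 //.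
  by rewrite mono_nil evr_ar mulrA.
apply: cpaP => -[i t] w; rewrite (ext_in _ w) /triangles /=.
rewrite ext_sum; under eq_bigr do rewrite ext_sum.
case: existsP => [[a /existsP[b /and3P[ha tb /eqP et]]]|n]; last first.
  rewrite big1 // => a ha; rewrite big1 // => b tb.
  have [t' [et' wt' ->]] := E a b ha tb; rewrite ext_mono wt' andbT.
  case: eqP => // -[_ e]; case: n; exists a; apply/existsP; exists b.
  by rewrite ha tb e et' eqxx.
have ei : i = hd b.
  by case: t et w => [|x t] // [ex _]; rewrite is_word_cons /= ex => /andP[/eqP].
rewrite (bigD1 a) //= (bigD1 b) //=; have [t' [et' wt' ->]] := E a b ha tb.
rewrite ext_mono wt' ei.
have -> : t = t' by apply: (inj_map val_inj); rewrite /= et et'.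
rewrite eqxx !big1 ?addr0 // => [a' /andP[ha' na]|b' /andP[tb' nb]].
  rewrite big1 // => b' tb'.
  have [t2 [et2 wt2 ->]] := E a' b' ha' tb'; rewrite ext_mono wt2 andbT.
  case: eqP => // -[_ e]; move: et'; rewrite e et2 => -[ea *].
  by rewrite ea eqxx in na.
have [t2 [et2 wt2 ->]] := E a b' ha tb'; rewrite ext_mono wt2 andbT.
case: eqP => // -[_ e]; move: et'; rewrite e et2 => /(congr1 (last (inr b))) -[eb].
by rewrite eb eqxx in nb.
Qed.

Lemma ldiv_sum_at i f : inm 1 f -> ev K Q i * f = f ->
  f = \sum_(a | hd a == i) ar K a * ldiv a f.
Proof.
move=> h e; rewrite {1}(ldiv_sum h) (bigID (fun a => hd a == i)) /=.
rewrite [X in _ + X]big1 ?addr0 // => a n.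
have -> : ldiv a f = 0; last by rewrite mulr0.
apply: cpaP => -[j s] _; rewrite ext_ldiv -e ext_evM (negbTE n) mul0r ext0.
by case: ifP.
Qed.

Lemma rdiv_sum_at i f : inm 1 f -> f * ev K Q i = f ->
  f = \sum_(a | tl a == i) rdiv a f * ar K a.
Proof.
move=> h e; rewrite {1}(rdiv_sum h) (bigID (fun a => tl a == i)) /=.
rewrite [X in _ + X]big1 ?addr0 // => a n.
have -> : rdiv a f = 0; last by rewrite mul0r.
apply: cpaP => -[j s] _; rewrite ext_rdiv -e ext_Mev wtail_rcons (negbTE n) mulr0 ext0.
by case: ifP.
Qed.

End Bracket.
Arguments lar K [V] k [Q] x.

(** * Extension of a right-equivalence to the mutated algebras *)

Section Extension.
Variables (K : fieldType) (V : finType) (k : V) (Q Q' : quiver V).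
Hypothesis no_loop : forall a : arr Q, hd a != tl a.
Hypothesis no_loop' : forall a : arr Q', hd a != tl a.
Variables (phi : cpa K Q -> cpa K Q') (psi : cpa K Q' -> cpa K Q).
Hypotheses (phi_hom : chom phi) (psi_hom : chom psi).
Hypothesis phiK : forall f, phi (psi f) = f.
Local Notation Qt := (mut_quiver Q k).
Local Notation Qt' := (mut_quiver Q' k).
Local Notation beta := (@bracketS K V Q k).
Local Notation beta' := (@bracketS K V Q' k).
Local Notation star := (fun j : arr Q' => lar K k (inr j : letter Q')).

Definition Lc (a : arr Q) (j : arr Q') := beta' (phi (ldiv a (psi (ar K j)))).
Definition Rc (b : arr Q) (j : arr Q') := beta' (phi (rdiv b (psi (ar K j)))).

(* The old arrows and the products [ba] follow [phi]. If [phi a_i = sum_j a'_j C_ji]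
   then [a_i^*] is sent to [sum_j (C^-1)_ij a'_j^*], and [C^-1] is read off [psi];
   dually for the arrows leaving [k]. *)
Definition rho (x : arr Qt) : cpa K Qt' :=
  match sval x with
  | inl _ => beta' (phi (unbr (ar K x)))
  | inr c => if hd c == k then \sum_(j | hd j == k) Lc c j * star j
             else \sum_(j | tl j == k) star j * Rc c j
  end.

Lemma hom_evl (Q1 Q2 : quiver V) (p : cpa K Q1 -> cpa K Q2) i f : chom p ->
  ev K Q1 i * f = f -> ev K Q2 i * p f = p f.
Proof. by case=> _ pM pe _ e; rewrite -pe -pM e. Qed.

Lemma hom_evr (Q1 Q2 : quiver V) (p : cpa K Q1 -> cpa K Q2) i f : chom p ->
  f * ev K Q1 i = f -> p f * ev K Q2 i = p f.
Proof. by case=> _ pM pe _ e; rewrite -pe -pM e. Qed.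

Lemma corner_hom (Q1 Q2 : quiver V) (p : cpa K Q1 -> cpa K Q2) f : chom p ->
  corner k f -> corner k (p f).
Proof.
case=> pc pM pe _ [cl cr]; split; first by rewrite -pe -pM cl lcont0.
by rewrite -pe -pM cr lcont0.
Qed.

Lemma hd_at (Q1 : quiver V) (a : arr Q1) : (forall b : arr Q1, hd b != tl b) ->
  tl a == k -> hd a != k.
Proof. by move=> nl /eqP <-. Qed.

Lemma tl_at (Q1 : quiver V) (a : arr Q1) : (forall b : arr Q1, hd b != tl b) ->
  hd a == k -> tl a != k.
Proof. by move=> nl /eqP <-; rewrite eq_sym. Qed.

Lemma ldiv_typed a j : ev K Q (tl a) * ldiv a (psi (ar K j)) = ldiv a (psi (ar K j)) /\
  ldiv a (psi (ar K j)) * ev K Q (tl j) = ldiv a (psi (ar K j)).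
Proof.
split; first exact: ldiv_evl.
by apply: ldiv_evr; apply: hom_evr => //; exact: evr_ar.
Qed.

Lemma rdiv_typed b j : ev K Q (hd j) * rdiv b (psi (ar K j)) = rdiv b (psi (ar K j)) /\
  rdiv b (psi (ar K j)) * ev K Q (hd b) = rdiv b (psi (ar K j)).
Proof.
split; last exact: rdiv_evr.
by apply: rdiv_evl; apply: hom_evl => //; exact: evl_ar.
Qed.

Lemma corner_ldiv a j : hd a == k -> hd j == k -> corner k (ldiv a (psi (ar K j))).
Proof.
move=> ha hj; have [el er] := ldiv_typed a j.
by apply: cornerP el er; apply: tl_at.
Qed.

Lemma corner_rdiv b j : tl b == k -> tl j == k -> corner k (rdiv b (psi (ar K j))).
Proof.
move=> tb tj; have [el er] := rdiv_typed b j.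
by apply: cornerP el er; apply: hd_at.
Qed.

Lemma Lc_l a j : hd a == k -> hd j == k -> ev K Qt' (tl a) * Lc a j = Lc a j.
Proof.
move=> ha hj; apply: beta_evl => //; first exact: tl_at.
  exact/corner_hom/corner_ldiv.
by apply: hom_evl => //; case: (ldiv_typed a j).
Qed.

Lemma Rc_l b j : tl b == k -> tl j == k -> ev K Qt' (hd j) * Rc b j = Rc b j.
Proof.
move=> tb tj; apply: beta_evl => //; first exact: hd_at.
  exact/corner_hom/corner_rdiv.
by apply: hom_evl => //; case: (rdiv_typed b j).
Qed.

Lemma Rc_r b j : tl b == k -> tl j == k -> Rc b j * ev K Qt' (hd b) = Rc b j.
Proof.
move=> tb tj; apply: beta_evr => //; first exact: hd_at.
  exact/corner_hom/corner_rdiv.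
by apply: hom_evr => //; case: (rdiv_typed b j).
Qed.

Lemma typed_inl (x : arr Qt) : (exists y, sval x = inl y) ->
  [/\ hd x != k, tl x != k, corner k (unbr (ar K x)) & inm 1 (unbr (ar K x))].
Proof.
rewrite unbr_ar => -[y ey].
have [h t] : hd x != k /\ tl x != k.
  move: ey; case: x => [[[a|[a b]]|c] v] //= _; first by move: v => /= /andP.
  by move: v => /= /andP[ha tb]; rewrite hd_at ?tl_at.
split=> //; last exact: inm_rhoU.
by apply: (cornerP h t); [exact: rhoU_l | exact: rhoU_r].
Qed.

Lemma rho_l x : ev K Qt' (hd x) * rho x = rho x.
Proof.
rewrite /rho; case e: (sval x) => [y|c].
  have [h t co _] := typed_inl (ex_intro _ y e).
  apply: beta_evl => //; first exact: corner_hom.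
  by apply: hom_evl => //; rewrite unbr_ar; exact: rhoU_l.
have ex : hd x = tl c by rewrite /= e.
rewrite ex; case: ifP => hc; rewrite mulr_sumr; apply: eq_bigr => j hj.
  by rewrite mulrA Lc_l.
have := valP x; rewrite /= e /= hc /= => /eqP ->.
by rewrite mulrA star_l.
Qed.

Lemma rho_r x : rho x * ev K Qt' (tl x) = rho x.
Proof.
rewrite /rho; case e: (sval x) => [y|c].
  have [h t co _] := typed_inl (ex_intro _ y e).
  apply: beta_evr => //; first exact: corner_hom.
  by apply: hom_evr => //; rewrite unbr_ar; exact: rhoU_r.
have ex : tl x = hd c by rewrite /= e.
rewrite ex; case: ifP => hc; rewrite mulr_suml; apply: eq_bigr => j hj.
  by rewrite -mulrA (eqP hc) star_r.
have tc : tl c == k by have := valP x; rewrite /= e /= hc.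
by rewrite -mulrA Rc_r.
Qed.

Lemma inm_rho x : inm 1 (rho x).
Proof.
rewrite /rho; case e: (sval x) => [y|c].
  by apply: beta_inm1; apply: (chom_inm phi_hom); case: (typed_inl (ex_intro _ y e)).
by case: ifP => _; apply: inm_sum => j _; [apply: inmMr|apply: inmMl]; exact: inm_lar.
Qed.

Definition hat := lift_hom rho.

Lemma hat_chom : chom hat.
Proof. exact: lift_chom rho_l rho_r inm_rho. Qed.

Lemma hat_ar x : hat (ar K x) = rho x.
Proof. exact: lift_ar rho_l rho_r inm_rho x. Qed.

Let unbrC := lift_chom (@rhoU_l K V k Q) (@rhoU_r K V k Q) (@inm_rhoU K V k Q).
Let unbrC' := lift_chom (@rhoU_l K V k Q') (@rhoU_r K V k Q') (@inm_rhoU K V k Q').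
Let nostarC := lift_chom (@rhoP_l K V k Q) (@rhoP_r K V k Q) (@inm_rhoP K V k Q).
Let nostarC' := lift_chom (@rhoP_l K V k Q') (@rhoP_r K V k Q') (@inm_rhoP K V k Q').

(** Each summand in the image of a dual arrow contains one dual arrow. This serves both [unbr] and
    [nostar]. *)
Lemma hat_star_kill (Q1 : quiver V) (p : cpa K Qt' -> cpa K Q1) (x : arr Qt) c :
  chom p -> (forall j : arr Q', p (star j) = 0) -> sval x = inr c -> p (rho x) = 0.
Proof.
move=> [pc pM _ _] p0 e; rewrite /rho e.
by case: ifP => _; rewrite lcont_sum // big1 // => j _; rewrite pM p0 ?mulr0 ?mul0r.
Qed.

Lemma unbr_hat f : unbr (hat f) = phi (unbr f).
Proof.
apply: (chom_eq (phi := fun x => unbr (hat x)) (psi := fun x => phi (unbr x))).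
- exact: chom_comp unbrC' hat_chom.
- exact: chom_comp phi_hom unbrC.
move=> x; rewrite hat_ar; case e: (sval x) => [y|c].
  have [_ _ co _] := typed_inl (ex_intro _ y e).
  by rewrite /rho e unbr_beta //; exact: corner_hom.
transitivity (0 : cpa K Q'); first exact: hat_star_kill unbrC' (@unbr_star K V k Q') e.
by rewrite unbr_ar /rhoU e lcont0 //; exact: chom_lcont.
Qed.

Lemma nostar_hat f : nostar (hat f) = hat (nostar f).
Proof.
apply: (chom_eq (phi := fun x => nostar (hat x)) (psi := fun x => hat (nostar x))).
- exact: chom_comp nostarC' hat_chom.
- exact: chom_comp hat_chom nostarC.
move=> x; rewrite nostar_ar hat_ar /rhoP; case e: (sval x) => [y|c].
  have [_ _ co _] := typed_inl (ex_intro _ y e).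
  by rewrite hat_ar /rho e nostar_beta //; exact: corner_hom.
transitivity (0 : cpa K Qt'); first exact: hat_star_kill nostarC' (@nostar_star K V k Q') e.
by rewrite lcont0 //; exact: chom_lcont hat_chom.
Qed.

(** The bracket of [f] is fixed by [nostar], which commutes with [hat] and factors as the bracket
    after [unbr]; as [unbr] carries [hat] to [phi], what remains is the bracket of [phi f]. *)
Lemma hat_beta f : corner k f -> hat (beta f) = beta' (phi f).
Proof.
move=> c; rewrite -{1}(nostar_beta no_loop c) -nostar_hat -beta_unbr.
by rewrite unbr_hat unbr_beta.
Qed.

Lemma hat_starl a : hd a == k ->
  hat (lar K k (inr a)) = \sum_(j | hd j == k) Lc a j * star j.
Proof.
move=> ha; have v : valid_letter k (inr a : letter Q) by rewrite /= ha.
by rewrite /lar insubT /= hat_ar /rho /= ha.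
Qed.

Lemma hat_starr b : tl b == k ->
  hat (lar K k (inr b)) = \sum_(j | tl j == k) star j * Rc b j.
Proof.
move=> tb; have v : valid_letter k (inr b : letter Q) by rewrite /= tb orbT.
by rewrite /lar insubT /= hat_ar /rho /= (negbTE (hd_at no_loop tb)).
Qed.

Lemma hat_triangles :
  csim0 (hat (@triangles K V Q k) - @triangles K V Q' k).
Proof.
have [hc hM _ _] := hat_chom; have [pc pM pe _] := phi_hom.
have [qc qM qe qI] := psi_hom.
(* The image of a triangle after C has cancelled against C^-1, without its last factor, the entry of
   D^-1. *)
pose X b j l := beta' (phi (ar K b) * ar K j) * star j * star l.
have corX b j : tl b == k -> hd j == k -> corner k (phi (ar K b) * ar K j).
  move=> tb hj; apply: (@cornerP _ _ _ _ (hd b) (tl j)).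
  - exact: hd_at.
  - exact: tl_at.
  - by rewrite mulrA (hom_evl phi_hom) // evl_ar.
  - by rewrite -mulrA evr_ar.
have corba (a b : arr Q) : hd a == k -> tl b == k -> corner k (ar K b * ar K a).
  move=> ha tb; apply: (@cornerP _ _ _ _ (hd b) (tl a)).
  - exact: hd_at.
  - exact: tl_at.
  - by rewrite mulrA evl_ar.
  - by rewrite -mulrA evr_ar.
(* Summing over [a] performs the cancellation: the products [phi a * phi (ldiv a (psi a'_j))] add up
   to [phi (psi a'_j)], that is, [a'_j]. *)
have -> : hat (@triangles K V Q k) = \sum_(b : arr Q | tl b == k)
    \sum_(j : arr Q' | hd j == k) \sum_(l : arr Q' | tl l == k) X b j l * Rc b l.
  rewrite trianglesE exchange_big lcont_sum //; apply: eq_bigr => b tb.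
  transitivity (\sum_(a : arr Q | hd a == k) \sum_(j : arr Q' | hd j == k)
     \sum_(l : arr Q' | tl l == k)
      beta' (phi (ar K b) * phi (ar K a) * phi (ldiv a (psi (ar K j)))) * star j * star l * Rc b l).
    rewrite lcont_sum //; apply: eq_bigr => a ha.
    rewrite !hM hat_starl // hat_starr // (lar_comp _ (eqP ha) (eqP tb)) hat_beta //;
      last exact: corba.
    rewrite -mulrA mulr_suml mulr_sumr; apply: eq_bigr => j hj.
    rewrite !mulr_sumr; apply: eq_bigr => l tl_l; rewrite !mulrA; congr (_ * _ * _ * _).
    rewrite -pM (betaM no_loop') //; first exact/corner_hom/corba.
    exact/corner_hom/corner_ldiv.
  rewrite exchange_big; apply: eq_bigr => j hj; rewrite exchange_big.
  apply: eq_bigr => l tl_l; rewrite -!mulr_suml; congr (_ * _ * _ * _).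
  rewrite -lcont_sum; last exact: beta_lcont.
  congr (beta' _); rewrite -{2}[ar K j]phiK.
  have e : ev K Q k * psi (ar K j) = psi (ar K j).
    by apply: hom_evl => //; rewrite -(eqP hj) evl_ar.
  rewrite {2}(ldiv_sum_at (qI _ _ (inm_ar _ _)) e) lcont_sum // mulr_sumr.
  by apply: eq_bigr => a ha; rewrite pM mulrA.
(* With the entry of D^-1 in front, the sum over [b] rebuilds [b'_l] from its last-arrow expansion
   under [psi]. *)
have -> : @triangles K V Q' k = \sum_(b : arr Q | tl b == k)
    \sum_(j : arr Q' | hd j == k) \sum_(l : arr Q' | tl l == k) Rc b l * X b j l.
  rewrite trianglesE [RHS]exchange_big; apply: eq_bigr => j hj; rewrite [RHS]exchange_big.
  apply: eq_bigr => l tl_l; rewrite (lar_comp _ (eqP hj) (eqP tl_l)).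
  under [RHS]eq_bigr do rewrite /X !mulrA.
  rewrite -!mulr_suml; congr (_ * _ * _).
  transitivity (\sum_(b | tl b == k) beta' (phi (rdiv b (psi (ar K l))) * (phi (ar K b) * ar K j))).
    rewrite -lcont_sum; last exact: beta_lcont.
    congr (beta' _); rewrite -{1}[ar K l]phiK.
    have e : psi (ar K l) * ev K Q k = psi (ar K l).
      by apply: hom_evr => //; rewrite -(eqP tl_l) evr_ar.
    rewrite {1}(rdiv_sum_at (qI _ _ (inm_ar _ _)) e) lcont_sum // mulr_suml.
    by apply: eq_bigr => b tb; rewrite pM mulrA.
  apply: eq_bigr => b tb; rewrite (betaM no_loop') //; last exact: corX.
  exact/corner_hom/corner_rdiv.
(* The two triple sums now differ termwise by a commutator of [X b j l], which goes from [hd l] to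
   [hd b], with [Rc b l], which goes back. *)
have cZ := @csim0_closed K V Qt'.
rewrite -sumrB; apply: (closed_sum cZ) => b tb; rewrite -sumrB.
apply: (closed_sum cZ) => j hj; rewrite -sumrB; apply: (closed_sum cZ) => l tl_l.
apply: (@csim0_comm _ _ _ (hd b) (hd l)).
- rewrite /X !mulrA beta_evl //; [exact: hd_at|exact: corX|].
  by rewrite mulrA (hom_evl phi_hom) // evl_ar.
- by rewrite /X -mulrA lar_r.
- exact: Rc_l.
- exact: Rc_r.
Qed.

End Extension.
Arguments hat [K V] k [Q Q'] phi psi f.

(** * The extensions of [phi] and [psi] are mutually inverse *)

Section Inverse.
Variables (K : fieldType) (V : finType) (k : V) (Q Q' : quiver V).
Hypothesis no_loop : forall a : arr Q, hd a != tl a.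
Hypothesis no_loop' : forall a : arr Q', hd a != tl a.
Variables (phi : cpa K Q -> cpa K Q') (psi : cpa K Q' -> cpa K Q).
Hypotheses (phi_hom : chom phi) (psi_hom : chom psi).
Hypotheses (phiK : forall f, phi (psi f) = f) (psiK : forall f, psi (phi f) = f).

Local Notation beta := (@bracketS K V Q k).

(** On a dual arrow two inverse matrices get multiplied. By the product rule for [ldiv] (or [rdiv])
    the entries combine into the quotient by [c] of [psi (phi a_l)], that is of the arrow [a_l],
    which is an idempotent for l = c and 0 otherwise. *)
Lemma hatK f : hat k psi phi (hat k phi psi f) = f.
Proof.
have [pc pM pe pI] := phi_hom; have [qc qM qe qI] := psi_hom.
have H1 := hat_chom k no_loop no_loop' phi_hom psi_hom.
have H2 := hat_chom k no_loop' no_loop psi_hom phi_hom.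
have hb2 := hat_beta no_loop' no_loop psi_hom phi_hom.
apply: (chom_eq (phi := fun x => hat k psi phi (hat k phi psi x)) (psi := id)).
- exact: chom_comp H2 H1.
- exact: chom_id.
move=> x; rewrite hat_ar // /rho; case e: (sval x) => [y|c].
  have [_ _ co _] := typed_inl K no_loop (ex_intro _ y e).
  rewrite hb2; last exact: corner_hom.
  by rewrite psiK beta_unbr nostar_ar /rhoP e.
have [c2 M2 _ _] := H2.
have ex : ar K x = lar K k (inr c) by rewrite -e larE.
have bc := @beta_lcont K V k Q.
case: ifP => hc.
  transitivity (\sum_(l | hd l == k)
      beta (ldiv c (ar K l)) * lar K k (inr l : letter Q)).
    transitivity (\sum_(l : arr Q | hd l == k) \sum_(j : arr Q' | hd j == k)
       beta (ldiv c (psi (ar K j)) * psi (ldiv j (phi (ar K l)))) * lar K k (inr l : letter Q)).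
      rewrite exchange_big lcont_sum //; apply: eq_bigr => j hj.
      rewrite M2 hat_starl // mulr_sumr /Lc.
      have co := corner_ldiv no_loop no_loop' psi_hom hc hj.
      rewrite hb2; last exact: corner_hom.
      rewrite psiK; apply: eq_bigr => l hl; rewrite mulrA betaM //.
      exact/corner_hom/corner_ldiv.
    apply: eq_bigr => l hl; rewrite -mulr_suml -lcont_sum //; congr (beta _ * _).
    have e1 : ev K Q' k * phi (ar K l) = phi (ar K l).
      by apply: hom_evl => //; rewrite -(eqP hl) evl_ar.
    rewrite -[in RHS](psiK (ar K l)) {2}(ldiv_sum_at (pI _ _ (inm_ar _ _)) e1).
    rewrite lcont_sum // lcont_sum; last exact: lcont_ldiv.
    apply: eq_bigr => j hj; rewrite qM ldivM1 //.
    exact/qI/inm_ar.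
  rewrite ex (bigD1 c) //= ldiv_ar eqxx beta_ev big1 ?addr0 => [|l /andP[_ n]].
    exact: (lar_l K k (inr c : letter Q)).
  by rewrite ldiv_ar eq_sym (negbTE n) lcont0 // mul0r.
have tc : tl c == k by have := valP x; rewrite /= e /= hc.
transitivity (\sum_(l | tl l == k)
    lar K k (inr l : letter Q) * beta (rdiv c (ar K l))).
  transitivity (\sum_(l : arr Q | tl l == k) \sum_(j : arr Q' | tl j == k)
     lar K k (inr l : letter Q) * beta (psi (rdiv j (phi (ar K l))) * rdiv c (psi (ar K j)))).
    rewrite exchange_big lcont_sum //; apply: eq_bigr => j hj.
    rewrite M2 hat_starr // mulr_suml /Rc.
    have co := corner_rdiv no_loop no_loop' psi_hom tc hj.
    rewrite hb2; last exact: corner_hom.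
    rewrite psiK; apply: eq_bigr => l hl; rewrite -mulrA betaM //.
    exact/corner_hom/corner_rdiv.
  apply: eq_bigr => l hl; rewrite -mulr_sumr -lcont_sum //; congr (_ * beta _).
  have e1 : phi (ar K l) * ev K Q' k = phi (ar K l).
    by apply: hom_evr => //; rewrite -(eqP hl) evr_ar.
  rewrite -[in RHS](psiK (ar K l)) {2}(rdiv_sum_at (pI _ _ (inm_ar _ _)) e1).
  rewrite lcont_sum // rdiv_sumr.
  apply: eq_bigr => j hj; rewrite qM rdivM1 //.
  exact/qI/inm_ar.
have rar l : rdiv c (ar K l) = if c == l then ev K Q (hd c) else 0.
  by rewrite -evl_ar rdivMar; case: eqP => // ->; rewrite evM eqxx.
rewrite ex (bigD1 c) //= rar eqxx beta_ev big1 ?addr0 => [|l /andP[_ n]].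
  exact: (lar_r K k (inr c : letter Q)).
by rewrite rar eq_sym (negbTE n) lcont0 // mulr0.
Qed.

End Inverse.

(** * Cyclic equivalence of bracketed potentials *)

Section CyclicTransfer.
Variables (K : fieldType) (V : finType) (k : V) (Q : quiver V).
Hypothesis no_loop : forall a : arr Q, hd a != tl a.
Local Notation Qt := (mut_quiver Q k).
Local Notation beta := (@bracketS K V Q k).
Implicit Types (f g h : cpa K Q) (a b : arr Q).

(* Cycles based at [k] are rotated by one arrow before taking brackets. *)
Definition shift_beta f : cpa K Qt :=
  beta ((1 - ev K Q k) * f * (1 - ev K Q k)) +
  \sum_(a | hd a == k) beta (ldiv a (f * ev K Q k) * ar K a).

Lemma shift_beta_lcont : lcont shift_beta.
Proof.
have bc := @beta_lcont K V k Q.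
apply: lcont_add.
  apply: (lcont_comp bc).
  exact: (lcont_comp (lcont_mulr _) (lcont_mull _)).
apply: lcont_bigsum => a _; apply: (lcont_comp bc); apply: (lcont_comp (lcont_mulr _)).
exact: (lcont_comp (@lcont_ldiv _ _ _ a) (lcont_mulr _)).
Qed.

Lemma shift_beta_corner f : corner k f -> shift_beta f = beta f.
Proof.
move=> [cl cr]; rewrite /shift_beta mulrBl mul1r cl subr0 mulrBr mulr1 cr subr0.
rewrite big1 ?addr0 // => a _; have lc := @lcont_ldiv K V Q a.
by rewrite (lcont0 lc) mul0r lcont0 //; exact: beta_lcont.
Qed.

Lemma shift_beta_at f : ev K Q k * f = f -> f * ev K Q k = f ->
  shift_beta f = \sum_(a | hd a == k) beta (ldiv a f * ar K a).
Proof.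
move=> el er; rewrite /shift_beta mulrBl mul1r el subrr mul0r.
by rewrite (lcont0 (@beta_lcont K V k Q)) add0r er.
Qed.

(** One elementary rotation, with cases according to which of the two base points [hd a] and [tl a]
    is [k]; they cannot both be, as there are no loops. *)
Lemma csim0_shift a y : ev K Q (tl a) * y = y -> y * ev K Q (hd a) = y ->
  csim0 (shift_beta (ar K a * y) - shift_beta (y * ar K a)).
Proof.
move=> yl yr; have bc := @beta_lcont K V k Q.
have [c0 _ _ _] := @csim0_closed K V Qt.
have ayl : ev K Q (hd a) * (ar K a * y) = ar K a * y by rewrite mulrA evl_ar.
have ayr : ar K a * y * ev K Q (hd a) = ar K a * y by rewrite -mulrA yr.
have yal : ev K Q (tl a) * (y * ar K a) = y * ar K a by rewrite mulrA yl.
have yar : y * ar K a * ev K Q (tl a) = y * ar K a by rewrite -mulrA evr_ar.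
(* Here [a y] is based at [k], and the correction term of [shift_beta] rotates it to exactly [y a]:
   the two values coincide. *)
have [ha|ha] := boolP (hd a == k).
  have ta := tl_at no_loop ha; rewrite [X in _ - X]shift_beta_corner; last exact: cornerP yal yar.
  rewrite shift_beta_at -?(eqP ha) // (bigD1 a) ?(eqP ha) //= big1 => [|b /andP[_ n]].
    by rewrite ldivM1 ?ldiv_ar ?eqxx ?yl ?addr0 ?subrr //; exact: inm_ar.
  rewrite ldivM1 ?ldiv_ar ?(negbTE n) ?mul0r ?lcont0 //; exact: inm_ar.
(* If neither end of [a] is [k], both factors lie in the corner and their brackets are commuted. *)
have [ta|ta] := boolP (tl a == k); last first.
  rewrite !shift_beta_corner; try exact: cornerP yal yar; try exact: cornerP ayl ayr.
  have ca : corner k (ar K a) by apply: cornerP (evl_ar K a) (evr_ar K a).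
  have cy : corner k y by apply: cornerP yl yr.
  rewrite !betaM //; apply: (@csim0_comm _ _ _ (hd a) (tl a)).
  - by apply: beta_evl => //; exact: evl_ar.
  - by apply: beta_evr => //; exact: evr_ar.
  - exact: beta_evl.
  - exact: beta_evr.
(* Remaining case: [a] leaves [k]. As [a] is no loop, [y] has no constant term, so it splits as the
   sum of [b * ldiv b y] over the arrows [b] entering [k], and [ab] is commuted past the bracket of
   [ldiv b y]. *)
have ym : inm 1 y.
  move=> [i [|? ?]] // _; apply/eqP/negPn/negP => nz.
  have e1 : i = tl a.
    by apply/eqP/negPn/negP => n; move: nz; rewrite -yl ext_evM (negbTE n) mul0r eqxx.
  have e2 : i = hd a.
    by apply/eqP/negPn/negP => n; move: nz; rewrite -yr ext_Mev [wtail _]/= (negbTE n) mulr0 eqxx.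
  by have := no_loop a; rewrite -e1 -e2 eqxx.
have yk := yl; rewrite (eqP ta) in yk.
have cld b : hd b == k -> corner k (ldiv b y).
  by move=> hb; apply: (cornerP _ ha (ldiv_evl b y) (ldiv_evr b yr)); exact: tl_at.
have cab b : hd b == k -> corner k (ar K a * ar K b).
  move=> hb; apply: (@cornerP _ _ _ _ (hd a) (tl b)) => //; first exact: tl_at.
    by rewrite mulrA evl_ar.
  by rewrite -mulrA evr_ar.
rewrite [X in X - _]shift_beta_corner; last exact: cornerP ayl ayr.
rewrite shift_beta_at -?(eqP ta) //.
rewrite (eqP ta) {1}(ldiv_sum_at ym yk) mulr_sumr lcont_sum // -sumrB.
apply: (closed_sum (@csim0_closed K V Qt)) => b hb.
have cb := cab b hb; have cl := cld b hb; have tb := tl_at no_loop hb.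
rewrite ldivM1 // -[_ * ar K a * ar K b]mulrA [ar K a * (ar K b * _)]mulrA.
rewrite (betaM no_loop cb cl) (betaM no_loop cl cb).
apply: (@csim0_comm _ _ _ (hd a) (tl b)).
- by apply: beta_evl => //; rewrite mulrA evl_ar.
- by apply: beta_evr => //; rewrite -mulrA evr_ar.
- by apply: beta_evl => //; exact: ldiv_evl.
- by apply: beta_evr => //; exact: ldiv_evr.
Qed.

(** Although [h] lies in the corner, the rotations approximating it need not. The bracket is thus
    replaced by [shift_beta], which agrees with it at [h] and is controlled on every rotation, and
    [csim0_min] is applied to the preimage of the cyclically trivial elements. *)
Lemma csim0_beta h : corner k h -> csim0 h -> csim0 (beta h).
Proof.
move=> c hh; rewrite -shift_beta_corner //.
have sc := shift_beta_lcont.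
apply: (csim0_min (Z := fun x => csim0 (shift_beta x))) hh.
  exact: closed_preim (@csim0_closed K V Qt) sc.
move=> [[i [|a s]] w] //; rewrite /cyclic /cyclicw /= wtail_cons => cy.
rewrite lcontB //; have := w; rewrite is_word_cons => /andP[/eqP ei w'].
rewrite mono_cons //.
have -> : mono K (rotw (i, a :: s)) = mono K (tl a, s) * ar K a.
  rewrite mono_ar // -(eqP cy) ei eqxx /rotw /=; congr (mono K (_, _)).
  case: s w' cy {w} => [|b s] w' cy; first by rewrite -ei (eqP cy).
  by move: w'; rewrite is_word_cons => /andP[/eqP].
apply: csim0_shift; first exact: mono_evl.
apply: cpaP => -[j t] _; rewrite ext_Mev ext_mono.
case: eqP => [[-> ->]|]; last by rewrite mul0r.
by rewrite -(eqP cy) ei eqxx mulr1.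
Qed.

End CyclicTransfer.

Theorem theorem5p2 (K : fieldType) (V : finType) (k : V)
  (Q : quiver V) (S : cpa K Q) (Q' : quiver V) (S' : cpa K Q') :
  isQP S -> cond_at k S ->
  isQP S' -> cond_at k S' ->
  right_equiv S S' ->
  right_equiv (mut_pot k S) (mut_pot k S').
Proof.
(* The condition at [k] speaks of starting points only; a path occurring in a potential is cyclic,
   so both of its ends avoid [k]. *)
have corS (Q1 : quiver V) (S1 : cpa K Q1) : potential S1 -> cond_at k S1 -> corner k S1.
  move=> pot [_ c].
  have key (p : pth Q1) : S1 p != 0 -> (sval p).1 != k /\ (sval p).1 = wtail (sval p).
    move=> nz; have cp : cyclic p by apply/negPn/negP => /pot /eqP; rewrite (negbTE nz).
    by split; [exact: c | case/andP: cp => _ /eqP].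
  split; apply: cpaP => -[i s] w; rewrite ?ext_evM ?ext_Mev ext0 (ext_in _ w).
    case: (i =P k) => [e|]; rewrite ?mul0r // mul1r; apply/eqP/negPn/negP => /key[] /=.
    by rewrite e eqxx.
  case: (wtail (i, s) =P k) => [e|]; rewrite ?mulr0 // mulr1.
  by apply/eqP/negPn/negP => /key[] /= nk ei; rewrite ei e eqxx in nk.
move=> [nl pS _] cS [nl' pS' _] cS' [phi [[[psi psiK phiK] pD pZ pM p1] pe equiv]].
have phi_hom : chom phi by apply: (chom_unital pD pZ pM) => i; exact: pe.
have psi_hom : chom psi.
  apply: chom_unital => [f g|c f|f g|i]; apply: (can_inj psiK); rewrite phiK.
  - by rewrite [RHS]pD !phiK.
  - by rewrite [RHS]pZ phiK.
  - by rewrite [RHS]pM !phiK.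
  - by rewrite [RHS]pe.
have H1 := hat_chom k nl nl' phi_hom psi_hom.
have [[hD hZ hc] hM he _] := H1.
have h1 : hat k phi psi 1 = 1.
  by rewrite -!sum_ev lcont_sum; [apply: eq_bigr|case: H1].
exists (hat k phi psi); split.
- split=> //; exists (hat k psi phi) => f; exact: hatK.
- move=> r; have er (Q1 : quiver V) : @cemb K V Q1 r = \sum_i r i *: ev K Q1 i.
    apply: cpaP => -[i s] _; rewrite ext_sum ext_emb.
    under eq_bigr do rewrite extZ ext_emb.
    case: s => [|_ _]; last by rewrite big1 // => j _; rewrite mulr0.
    rewrite (bigD1 i) //= eqxx mulr1 big1 ?addr0 // => j.
    by rewrite eq_sym => /negbTE ->; rewrite mulr0.
  rewrite !er lcont_sum; last by case: H1.
  by apply: eq_bigr => i _; rewrite hZ he.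
apply/csim0E; rewrite /mut_pot.
(* The bracketed potentials and the triangles are compared separately: the first part is the bracket
   of the cyclically trivial corner element [phi S - S']. *)
have -> : hat k phi psi (cadd (@bracketS K V Q k S) (@triangles K V Q k)) -
    cadd (@bracketS K V Q' k S') (@triangles K V Q' k) =
    @bracketS K V Q' k (phi S - S') + (hat k phi psi (@triangles K V Q k) - @triangles K V Q' k).
  rewrite [hat _ _ _ _]hD hat_beta //; last exact: corS.
  by rewrite (lcontB _ _ (@beta_lcont K V k Q')) addrACA -opprD.
have [_ cD _ _] := @csim0_closed K V (mut_quiver Q' k).
apply: cD; last exact: hat_triangles.
apply: csim0_beta => //; last exact: (iffLR (csim0E _ _) equiv).
have [cl cr] := corner_hom phi_hom (corS _ _ pS cS); have [cl' cr'] := corS _ _ pS' cS'.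
by split; rewrite ?mulrBr ?mulrBl ?cl ?cl' ?cr ?cr' subr0.
Qed.
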